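(* Let $P$ be a parabolic subgroup of a real reductive Lie group $G$, with unipotent radical $N_P$ and $\mathfrak n=\mathrm{Lie}(N_P)$, and let $\pi$ be in $\mathrm{Rep}^{\infty,F}(P)$. Put $\mathbf{CJ}^{\infty}(\pi)=\varprojlim_k\pi/\overline{\mathfrak n^k.\pi}$ and $\mathbf{CJ}^\infty_s(\pi)=\bigcap_{k\ge0}\overline{\mathfrak n^k.\pi}$. Then: (1) The functor $\mathbf{CJ}^{\infty}$ is well-defined, i.e. $\mathbf{CJ}^{\infty}(\pi)$ is of moderate growth. (2) The natural map from $\pi$ to $\mathbf{CJ}^{\infty}(\pi)$ is surjective. (3) As representations in $\mathrm{Rep}^{\infty,F}(P)$, $\pi/\mathbf{CJ}_s^{\infty}(\pi)\cong\mathbf{CJ}^{\infty}(\pi)$.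
   Context: Fix an algebraic scale $\|\cdot\|_G$ on $G$, e.g. $\|g\|_G=\mathrm{tr}(\rho(g)\rho(g)^* )+\mathrm{tr}(\rho(g^{-1})\rho(g^{-1})^* )$ for a finite-dimensional representation $\rho$ with finite kernel and closed image. $\mathrm{Rep}^{\infty,F}(P)$ is the category of smooth Fréchet representations of $P$ of moderate growth: complex Fréchet spaces $\pi$ with a continuous linear $P$-action with smooth orbit maps such that for every continuous seminorm $p_1$ there are $r\ge0$ and a continuous seminorm $p_2$ with $p_1(g.v)\le\|g\|_G^rp_2(v)$ for all $g\in P$, $v\in\pi$; morphisms are continuous $P$-equivariant linear maps. $\mathfrak n^k.\pi$ is the span of all $X_1\cdots X_k.v$ with $X_i\in\mathfrak n$, $v\in\pi$ ($\mathfrak n^0.\pi=\pi$); closures are in $\pi$. $\mathbf{CJ}^\infty(\pi)$ carries the inverse limit topology and $\mathbf{CJ}_s^\infty(\pi)$ the subspace topology. *)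

(* Defs.v *)
From HB Require Import structures.
From mathcomp Require Import all_boot all_order all_algebra ring_quotient.
From mathcomp Require Import all_classical all_reals all_analysis.
From mathcomp Require Import complex.

Set Implicit Arguments.
Unset Strict Implicit.
Unset Printing Implicit Defensive.

Import Order.TTheory GRing.Theory Num.Theory.
Import numFieldNormedType.Exports.

Local Open Scope classical_set_scope.
Local Open Scope ring_scope.
Local Open Scope complex_scope.

Definition subspace_set (K : pzRingType) (V : lmodType K) (S : set V) : Prop :=
  S 0 /\ forall (a : K) (u v : V), S u -> S v -> S (a *: u + v).

Record submod (K : pzRingType) (V : lmodType K) := Submod {
  submod_set :> V -> Prop;
  submodP : subspace_set submod_set }.

Definition span_set (K : pzRingType) (V : lmodType K) (A : set V) : set V :=
  \bigcap_(S in [set S | subspace_set S /\ A `<=` S]) S.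

Section Submodules.
Variables (K : pzRingType) (V : lmodType K).

Lemma submod0 (S : submod V) : S 0. Proof. exact: (submodP S).1. Qed.

Lemma submodZD (S : submod V) a u v : S u -> S v -> S (a *: u + v).
Proof. exact: (submodP S).2. Qed.

Lemma submodD (S : submod V) u v : S u -> S v -> S (u + v).
Proof. by move=> Su Sv; rewrite -[u]scale1r; exact: submodZD. Qed.

Lemma submodZ (S : submod V) a u : S u -> S (a *: u).
Proof. by move=> Su; rewrite -[_ *: _]addr0; apply: submodZD => //; exact: submod0. Qed.

Lemma submodN (S : submod V) u : S u -> S (- u).
Proof. by rewrite -scaleN1r; exact: submodZ. Qed.

Lemma span_setP (A : set V) : subspace_set (span_set A).
Proof.
split=> [S [[S0 _] _]//|a u v Au Av S SA].
by case: (SA) => -[_ SZD] _; apply: SZD; [exact: Au|exact: Av].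
Qed.

Lemma sub_span_set (A : set V) : A `<=` span_set A.
Proof. by move=> u Au S [_]; apply. Qed.

Lemma span_set_min (A : set V) (S : submod V) : A `<=` S -> span_set A `<=` S.
Proof. by move=> AS u; apply; split => //; exact: submodP. Qed.

Lemma bigcap_subspace (I : Type) (S : I -> submod V) :
  subspace_set (\bigcap_i S i).
Proof.
split=> [i _|a u v Su Sv i _]; first exact: submod0.
by apply: submodZD; [exact: Su|exact: Sv].
Qed.

Definition span_submod (A : set V) : submod V := Submod (span_setP A).
Definition bigcap_submod (I : Type) (S : I -> submod V) : submod V :=
  Submod (bigcap_subspace S).

End Submodules.

Section ClosureSubmod.
Variables (K : numFieldType) (V : topologicalLmodType K).

Lemma closure_subspace (S : submod V) : subspace_set (closure (S : set V)).
Proof.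
split=> [|a u v Su Sv B]; first exact/subset_closure/submod0.
move=> /(@add_continuous V (a *: u, v)) [[A1 A2]/= [nA1 nA2] A12].
have [[C1 C2]/= [nC1 nC2] C12] := @scale_continuous K V (a, u) _ nA1.
have [u' [Su' Cu']] := Su _ nC2.
have [v' [Sv' Av']] := Sv _ nA2.
exists (a *: u' + v'); split; first exact: submodZD.
apply: (A12 (_, _)); split => //=; apply: (C12 (_, _)); split => //=.
exact: nbhs_singleton.
Qed.

Definition closure_submod (S : submod V) : submod V :=
  Submod (closure_subspace S).

End ClosureSubmod.

Section QuotientModule.
Variables (K : numFieldType) (V : topologicalLmodType K) (S : submod V).

Definition in_submod : {pred V} := fun v => `[< S v >].

Lemma in_submodP : zmod_closed in_submod.
Proof.
split=> [|u v]; rewrite !unfold_in; first exact/asboolP/submod0.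
by move=> /asboolP Su /asboolP Sv; apply/asboolP/submodD => //; exact: submodN.
Qed.

HB.instance Definition _ := GRing.isZmodClosed.Build V in_submod in_submodP.

Definition qspace : Type := quotient_topology (Quotient.quot in_submod).

HB.instance Definition _ := Topological.on qspace.
HB.instance Definition _ := @GRing.isZmodule.Build qspace
  (Quotient.zero in_submod) (@Quotient.opp V in_submod)
  (@Quotient.add V in_submod) (@Quotient.addqA V in_submod)
  (@Quotient.addqC V in_submod) (@Quotient.add0q V in_submod)
  (@Quotient.addNq V in_submod).

Definition qproj (v : V) : qspace := \pi_(Quotient.quot in_submod)%qT v.
Definition qrepr (x : qspace) : V := repr (x : Quotient.quot in_submod).

Lemma qreprK x : qproj (qrepr x) = x.
Proof. exact: reprK. Qed.

Lemma qproj_eq u v : qproj u = qproj v <-> S (u - v).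
Proof.
have E := Quotient.idealrBE in_submod u v.
split=> [uv|Suv].
  by apply/asboolP; rewrite -[asbool _]/(u - v \in in_submod) E; apply/eqP.
have /eqP // : (u == v %[mod Quotient.quot in_submod])%qT.
by rewrite -E; exact/asboolP.
Qed.

Lemma qrepr_proj v : S (qrepr (qproj v) - v).
Proof. by apply/qproj_eq; rewrite qreprK. Qed.

Lemma qprojD u v : qproj (u + v) = qproj u + qproj v.
Proof. exact: Quotient.pi_add. Qed.

Definition qscale (a : K) (x : qspace) : qspace := qproj (a *: qrepr x).

Lemma qprojZ a v : qproj (a *: v) = qscale a (qproj v).
Proof.
apply/esym/qproj_eq; rewrite -scalerBr; apply: submodZ; exact: qrepr_proj.
Qed.

Lemma qscaleA a b x : qscale a (qscale b x) = qscale (a * b) x.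
Proof. by rewrite -[x]qreprK -!qprojZ scalerA. Qed.

Lemma qscale1 : left_id 1 qscale.
Proof. by move=> x; rewrite -[x]qreprK -!qprojZ scale1r. Qed.

Lemma qscaleDr : right_distributive qscale +%R.
Proof.
by move=> a x y; rewrite -[x]qreprK -[y]qreprK -qprojD -!qprojZ scalerDr qprojD.
Qed.

Lemma qscaleDl x : {morph qscale^~ x : a b / a + b}.
Proof. by move=> a b /=; rewrite -[x]qreprK -!qprojZ scalerDl qprojD. Qed.

HB.instance Definition _ := GRing.Zmodule_isLmodule.Build K qspace
  qscaleA qscale1 qscaleDr qscaleDl.

Lemma qproj_continuous : continuous qproj.
Proof. exact: pi_continuous. Qed.

Lemma qproj_open (A : set V) : open A -> open (qproj @` A).
Proof.
move=> oA; rewrite /open/= /quotient_open.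
rewrite (_ : _ @^-1` _ = \bigcup_(w in S) ((fun v => v + w) @^-1` A)).
  apply: bigcup_open => w _; apply: open_comp => // v _.
  apply: (@continuous_comp _ _ _ (fun v => (v, w)) (fun z : V * V => z.1 + z.2)).
    by apply: cvg_pair; [exact: cvg_id|exact: cvg_cst].
  exact: add_continuous.
apply/seteqP; split=> [v [a Aa /qproj_eq Sav]|v [w Sw Avw]].
  by exists (a - v) => //; rewrite /= addrC subrK.
by exists (v + w) => //; apply/qproj_eq; rewrite addrAC subrr add0r.
Qed.

Lemma nbhs_qproj v (A : set V) : nbhs v A -> nbhs (qproj v) (qproj @` A).
Proof.
rewrite nbhsE => -[B [oB Bv] BA]; rewrite nbhsE; exists (qproj @` B).
  by split; [exact: qproj_open|exists v].
exact: image_subset.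
Qed.

Lemma qadd_continuous : continuous (fun z : qspace * qspace => z.1 + z.2).
Proof.
move=> [x y] U; rewrite -[x]qreprK -[y]qreprK /= -qprojD => nU.
have [[A B]/= [nA nB] AB] :=
  @add_continuous V (qrepr x, qrepr y) _ (qproj_continuous nU).
exists (qproj @` A, qproj @` B) => /=.
  by split; exact: nbhs_qproj.
move=> [_ _] [/= [a Aa <-] [b Bb <-]]; rewrite -qprojD.
exact: (AB (a, b)).
Qed.

Lemma qscale_continuous : continuous (fun z : K^o * qspace => z.1 *: z.2).
Proof.
move=> [k x] U; rewrite -[x]qreprK /= -[k *: _]qprojZ => nU.
have [[A B]/= [nA nB] AB] :=
  @scale_continuous K V (k, qrepr x) _ (qproj_continuous nU).
exists (A, qproj @` B) => /=.
  by split=> //; exact: nbhs_qproj.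
move=> [a _] [/= Aa [b Bb <-]]; rewrite -[_ *: _]qprojZ.
exact: (AB (a, b)).
Qed.

HB.instance Definition _ :=
  PreTopologicalNmodule_isTopologicalNmodule.Build qspace qadd_continuous.
HB.instance Definition _ :=
  TopologicalNmodule_isTopologicalLmodule.Build K qspace qscale_continuous.

End QuotientModule.

Record filtration (K : pzRingType) (V : lmodType K) := Filtration {
  filtr :> nat -> submod V;
  filtrP : forall j k, (j <= k)%N -> filtr k `<=` filtr j }.

Section InverseLimit.
Variables (K : numFieldType) (V : topologicalLmodType K) (F : filtration V).

(* the transition map V / F k -> V / F j sends [v] to [v] *)
Definition coherent (x : forall k, qspace (F k)) : Prop :=
  forall j k, (j <= k)%N -> qproj (F j) (qrepr (x k)) = x j.

Record invlim := Invlim {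
  lim_proj :> forall k, qspace (F k);
  lim_coherent : coherent lim_proj }.

Lemma invlim_ext (x y : invlim) : (forall k, x k = y k) -> x = y.
Proof.
case: x y => [x cx] [y cy] /= xy.
have {}xy : x = y by apply: functional_extensionality_dep.
by move: cx; rewrite xy => cx; congr Invlim; exact: Prop_irrelevance.
Qed.

Lemma coherent_lift (x : invlim) j k : (j <= k)%N ->
  forall v, x k = qproj _ v -> x j = qproj _ v.
Proof.
move=> jk v xk; rewrite -(lim_coherent x jk) xk; apply/qproj_eq.
exact: (filtrP jk) (qrepr_proj _ _).
Qed.

Lemma coherent_op (x y : invlim) (a : K) :
  coherent (fun k => a *: x k + y k).
Proof.
move=> j k jk; set u := qrepr (x k); set v := qrepr (y k).
have xk : x k = qproj _ u by rewrite qreprK.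
have yk : y k = qproj _ v by rewrite qreprK.
rewrite (coherent_lift jk xk) (coherent_lift jk yk) xk yk.
rewrite -![_ *: qproj _ _]qprojZ -!qprojD; apply/qproj_eq.
exact: (filtrP jk) (qrepr_proj _ _).
Qed.

Lemma coherent_nat v : coherent (fun k => qproj (F k) v).
Proof.
move=> j k jk; apply/qproj_eq.
exact: (filtrP jk) (qrepr_proj _ _).
Qed.

Definition lim_nat (v : V) : invlim := Invlim (coherent_nat v).

Lemma lim_add_subproof (x y : invlim) : coherent (fun k => x k + y k).
Proof.
move=> j k jk; have := coherent_op x y 1 jk.
by rewrite !scale1r.
Qed.

Lemma lim_scale_subproof a (x : invlim) : coherent (fun k => a *: x k).
Proof.
move=> j k jk; have := coherent_op x (lim_nat 0) a jk.
have q0 i : qproj (F i) 0 = 0 by apply: (addrI (qproj (F i) 0)); rewrite -qprojD !addr0.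
by rewrite /= !q0 !addr0.
Qed.

Definition lim_add x y := Invlim (lim_add_subproof x y).
Definition lim_scale a x := Invlim (lim_scale_subproof a x).

HB.instance Definition _ := gen_eqMixin invlim.
HB.instance Definition _ := gen_choiceMixin invlim.

Lemma lim_addA : associative lim_add.
Proof. by move=> x y z; apply: invlim_ext => k /=; rewrite addrA. Qed.
Lemma lim_addC : commutative lim_add.
Proof. by move=> x y; apply: invlim_ext => k /=; rewrite addrC. Qed.
Lemma lim_add0 : left_id (lim_scale 0 (lim_nat 0)) lim_add.
Proof. by move=> x; apply: invlim_ext => k /=; rewrite scale0r add0r. Qed.
Lemma lim_addN : left_inverse (lim_scale 0 (lim_nat 0)) (lim_scale (-1)) lim_add.
Proof. by move=> x; apply: invlim_ext => k /=; rewrite scaleN1r scale0r addNr. Qed.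

HB.instance Definition _ := GRing.isZmodule.Build invlim
  lim_addA lim_addC lim_add0 lim_addN.

Lemma lim_scaleA a b x : lim_scale a (lim_scale b x) = lim_scale (a * b) x.
Proof. by apply: invlim_ext => k /=; rewrite scalerA. Qed.
Lemma lim_scale1 : left_id 1 lim_scale.
Proof. by move=> x; apply: invlim_ext => k /=; rewrite scale1r. Qed.
Lemma lim_scaleDr : right_distributive lim_scale +%R.
Proof. by move=> a x y; apply: invlim_ext => k /=; rewrite scalerDr. Qed.
Lemma lim_scaleDl x : {morph lim_scale^~ x : a b / a + b}.
Proof. by move=> a b /=; apply: invlim_ext => k /=; rewrite scalerDl. Qed.

HB.instance Definition _ := GRing.Zmodule_isLmodule.Build K invlim
  lim_scaleA lim_scale1 lim_scaleDr lim_scaleDl.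

HB.instance Definition _ := Topological.copy invlim
  (initial_topology
    (fun x : invlim => (fun k => x k) : prod_topology (fun k => qspace (F k)))).

Lemma lim_proj_continuous k : continuous (fun x : invlim => x k).
Proof.
move=> x; apply: (@continuous_comp _ _ _ (fun x : invlim =>
  (fun k => x k) : prod_topology (fun k => qspace (F k))) (proj k)).
  exact: initial_continuous.
exact: proj_continuous.
Qed.

Lemma continuous_to_lim (T : topologicalType) (f : T -> invlim) :
  (forall k, continuous (fun t => f t k)) -> continuous f.
Proof.
move=> cf; apply: continuous_comp_initial => t.
apply/cvg_sup => k; apply: (@continuous_comp_initial _ _ _ _ _) => //.
exact: cf.
Qed.

Lemma lim_add_continuous : continuous (fun z : invlim * invlim => z.1 + z.2).
Proof.
apply: continuous_to_lim => k z.
apply: (@continuous_comp _ _ _ (fun z : invlim * invlim => (z.1 k, z.2 k))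
  (fun z => z.1 + z.2)); last exact: add_continuous.
apply: (@cvg_pair _ _ _ _ (nbhs (z.1 k)) (nbhs (z.2 k))).
  by apply: (@continuous_comp _ _ _ fst (fun x : invlim => x k));
    [exact: cvg_fst|exact: lim_proj_continuous].
by apply: (@continuous_comp _ _ _ snd (fun x : invlim => x k));
  [exact: cvg_snd|exact: lim_proj_continuous].
Qed.

Lemma lim_scale_continuous : continuous (fun z : K^o * invlim => z.1 *: z.2).
Proof.
apply: continuous_to_lim => k z.
apply: (@continuous_comp _ _ _ (fun z : K^o * invlim => (z.1, z.2 k))
  (fun z : K^o * _ => z.1 *: z.2)); last exact: scale_continuous.
apply: (@cvg_pair _ _ _ _ (nbhs (z.1 : K^o)) (nbhs (z.2 k))).
  exact: cvg_fst.
by apply: (@continuous_comp _ _ _ snd (fun x : invlim => x k));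
  [exact: cvg_snd|exact: lim_proj_continuous].
Qed.

HB.instance Definition _ :=
  PreTopologicalNmodule_isTopologicalNmodule.Build invlim lim_add_continuous.
HB.instance Definition _ :=
  TopologicalNmodule_isTopologicalLmodule.Build K invlim lim_scale_continuous.

End InverseLimit.

HB.mixin Record isTopGroup G of Topological G & Group G := {
  mulg_continuous : continuous (fun z : G * G => (z.1 * z.2)%g);
  invg_continuous : continuous (fun g : G => (g^-1)%g) }.

#[short(type="topGroupType")]
HB.structure Definition TopGroup :=
  {G of isTopGroup G & Topological G & Group G}.

Definition is_subgroup (G : groupType) (H : set G) : Prop :=
  [/\ H 1%g, (forall g h, H g -> H h -> H (g * h)%g)
    & (forall g, H g -> H (g^-1)%g)].

Definition unipotent (F : fieldType) (n : nat) (A : 'M[F]_n.+1) : Prop :=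
  exists k, (A - 1) ^+ k = 0.

Definition mx_subgroup (F : fieldType) (n : nat) (H : set 'M[F]_n.+1) : Prop :=
  [/\ H `<=` [set A | A \is a GRing.unit], H 1,
      (forall A B, H A -> H B -> H (A * B))
    & (forall A, H A -> H A^-1)].

(* The unipotent radical of a linear algebraic group H over a field of
   characteristic 0 is its largest normal subgroup consisting of unipotent
   elements: such subgroups have unipotent Zariski closure, and unipotent
   algebraic groups are connected in characteristic 0. *)
Definition trivial_unipotent_radical (F : fieldType) (n : nat)
    (H : set 'M[F]_n.+1) : Prop :=
  forall U : set 'M[F]_n.+1, mx_subgroup U -> U `<=` H ->
    (forall A B, H A -> U B -> U (A * B * A^-1)) ->
    U `<=` @unipotent F n -> U = [set 1].

Section RealReductive.
Variable R : realType.

Inductive real_polyfun (n : nat) : ('M[R[i]]_n.+1 -> R[i]) -> Prop :=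
| Polyfun_const (a : R) : real_polyfun (fun=> a%:C)
| Polyfun_coord i j : real_polyfun (fun A => A i j)
| Polyfun_add f g :
    real_polyfun f -> real_polyfun g -> real_polyfun (fun A => f A + g A)
| Polyfun_mul f g :
    real_polyfun f -> real_polyfun g -> real_polyfun (fun A => f A * g A).

Definition zero_locus (n : nat) (E : set ('M[R[i]]_n.+1 -> R[i])) :
    set 'M[R[i]]_n.+1 :=
  [set A | A \is a GRing.unit /\ forall f, E f -> f A = 0].

Definition reductive_algebraic (n : nat) (H : set 'M[R[i]]_n.+1) : Prop :=
  exists E : set ('M[R[i]]_n.+1 -> R[i]),
    [/\ E `<=` @real_polyfun n, H = zero_locus E, mx_subgroup H
      & trivial_unipotent_radical H].

Definition real_points (n : nat) (H : set 'M[R[i]]_n.+1) : set 'M[R]_n.+1 :=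
  [set A | H (map_mx (real_complex R) A)].

Variables (G : topGroupType) (n : nat) (rho : G -> 'M[R]_n.+1).

(* G is real reductive in the sense of Wallach: rho is a finite covering of an
   open subgroup of the real points of a reductive algebraic group.  In
   particular rho is a representation with finite kernel and closed image. *)
Definition real_reductive : Prop :=
  [/\ hausdorff_space G, continuous rho,
      (rho 1%g = 1 /\ forall g h, rho (g * h)%g = rho g * rho h),
      finite_set [set g | rho g = 1]
    & exists2 H, reductive_algebraic H &
        forall U : set G, open U ->
          exists2 O, open O & rho @` U = O `&` real_points H].

Definition scale_of (g : G) : R :=
  \tr (rho g *m (rho g)^T) + \tr (rho (g^-1)%g *m (rho (g^-1)%g)^T).

(* Scales matter only up to polynomial domination in both directions, and all
   algebraic scales of G are equivalent to scale_of in this sense. *)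
Definition algebraic_scale (s : G -> R) : Prop :=
  (forall g, 0 < s g) /\
  exists c k, forall g, s g <= c * scale_of g ^+ k /\ scale_of g <= c * s g ^+ k.

(* gamma is the one-parameter subgroup t |-> exp (t X) of G, Lie(G) being
   realized inside the matrices through d rho *)
Definition one_param (X : 'M[R]_n.+1) (gamma : R -> G) : Prop :=
  [/\ continuous gamma, (forall s t, gamma (s + t) = (gamma s * gamma t)%g)
    & is_derive (0 : R) 1 (rho \o gamma) X].

Definition LieAlg (H : set G) : set 'M[R]_n.+1 :=
  [set X | exists2 gamma, one_param X gamma & forall t, H (gamma t)].

(* the exponential map of G; a junk value is returned outside Lie(G) *)
Definition gexp (X : 'M[R]_n.+1) : G :=
  xget 1%g [set g | exists2 gamma, one_param X gamma & gamma 1 = g].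

Definition mx_bracket (F : fieldType) (X Y : 'M[F]_n.+1) := X * Y - Y * X.

Definition lie_subalgebra (F : fieldType) (h : set 'M[F]_n.+1) : Prop :=
  subspace_set h /\ forall X Y, h X -> h Y -> h (mx_bracket X Y).

Definition derived_alg (F : fieldType) (h : set 'M[F]_n.+1) :
    set 'M[F]_n.+1 :=
  span_set [set mx_bracket X Y | X in h & Y in h].

Definition lie_solvable (F : fieldType) (h : set 'M[F]_n.+1) : Prop :=
  exists k, iter k (@derived_alg F) h = [set 0].

Definition borel_subalgebra (F : fieldType) (g b : set 'M[F]_n.+1) : Prop :=
  [/\ lie_subalgebra b, b `<=` g, lie_solvable b
    & forall b', lie_subalgebra b' -> b' `<=` g -> lie_solvable b' ->
        b `<=` b' -> b' = b].

Definition complexification (h : set 'M[R]_n.+1) : set 'M[R[i]]_n.+1 :=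
  [set map_mx (real_complex R) X + 'i *: map_mx (real_complex R) Y
     | X in h & Y in h].

Definition parabolic_subalgebra (p : set 'M[R]_n.+1) : Prop :=
  [/\ lie_subalgebra p, p `<=` LieAlg setT
    & exists2 b, borel_subalgebra (complexification (LieAlg setT)) b
                 & b `<=` complexification p].

(* the normalizer in G of a parabolic subalgebra *)
Definition parabolic_subgroup (P : set G) : Prop :=
  exists2 p, parabolic_subalgebra p &
    P = [set g | (fun X => rho g * X * (rho g)^-1) @` p = p].

Definition unipotent_normal (P U : set G) : Prop :=
  [/\ is_subgroup U, U `<=` P,
      (forall g u, P g -> U u -> U (g * u * g^-1)%g),
      connected U & forall u, U u -> unipotent (rho u)].

Definition unipotent_radical (P N : set G) : Prop :=
  unipotent_normal P N /\ forall U, unipotent_normal P U -> U `<=` N.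

End RealReductive.

Section Frechet.
Variables (R : realType) (V : topologicalLmodType R[i]).

Definition seminorm (p : V -> R) : Prop :=
  (forall u v, p (u + v) <= p u + p v) /\
  (forall (a : R[i]) v, p (a *: v) = complex.Re `|a| * p v).

Definition continuous_seminorm (p : V -> R) : Prop :=
  seminorm p /\ continuous p.

(* Completeness is stated for sequences, which suffices by metrizability. *)
Definition frechet : Prop :=
  (exists p : nat -> V -> R,
     [/\ forall i, seminorm (p i),
         forall v, (forall i, p i v = 0) -> v = 0
       & forall U : set V, nbhs 0 U <->
           exists m (e : R), 0 < e /\
             [set v | forall i, (i < m)%N -> p i v < e] `<=` U]) /\
  (forall u : nat -> V,
     (forall U : set V, nbhs 0 U -> exists m, forall i j,
        (m <= i)%N -> (m <= j)%N -> U (u i - u j)) ->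
     exists l : V, u @ \oo --> l).

Definition deriv0 (c : R -> V) (w : V) : Prop :=
  (fun h : R => (h^-1)%:C *: (c h - c 0)) @ 0^' --> w.

Variable n : nat.

(* f is of class C^k on U `&` L, for U open and L a linear subspace *)
Fixpoint class_C (k : nat) (L U : set 'M[R]_n.+1) (f : 'M[R]_n.+1 -> V) : Prop :=
  {within U `&` L, continuous f} /\
  if k is k'.+1 then
    forall Y, L Y -> exists2 f' : 'M[R]_n.+1 -> V,
      (forall X, (U `&` L) X -> deriv0 (fun h => f (X + h *: Y)) (f' X))
      & class_C k' L U f'
  else True.

Definition smooth_near0 (L : set 'M[R]_n.+1) (f : 'M[R]_n.+1 -> V) : Prop :=
  exists2 U : set 'M[R]_n.+1, open_nbhs (0 : 'M[R]_n.+1) U & forall k, class_C k L U f.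

End Frechet.

(* A space with an action of a subgroup P of G; only the values of rep_act on P
   are meaningful. *)
Record rep_space (R : realType) (G : topGroupType) := RepSpace {
  rep_car :> topologicalLmodType R[i];
  rep_act : G -> rep_car -> rep_car }.

Section Representations.
Variables (R : realType) (G : topGroupType) (n : nat) (rho : G -> 'M[R]_n.+1).
Variables (s : G -> R) (P : set G).

(* f : P -> V is smooth, tested in the exponential charts
   X |-> g exp(X), X in Lie(P), around each point g of P *)
Definition smooth_on (V : topologicalLmodType R[i]) (f : G -> V) : Prop :=
  forall g, P g ->
    smooth_near0 (LieAlg rho P) (fun X => f (g * gexp rho X)%g).

Definition moderate_growth (V : rep_space R G) : Prop :=
  forall p1 : V -> R, continuous_seminorm p1 ->
    exists r : R, exists2 p2 : V -> R, 0 <= r /\ continuous_seminorm p2 &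
      forall g v, P g -> p1 (rep_act g v) <= s g `^ r * p2 v.

Definition in_RepF (V : rep_space R G) : Prop :=
  frechet V /\
  [/\ ((forall v : V, rep_act 1%g v = v) /\
        forall g h (v : V), P g -> P h ->
          rep_act (g * h)%g v = rep_act g (rep_act h v)),
      (forall g, P g -> linear (@rep_act _ _ V g)),
      {within P `*` [set: V], continuous (fun z : G * V => rep_act z.1 z.2)},
      (forall v : V, smooth_on (fun g => rep_act g v))
    & moderate_growth V].

Definition rep_morphism (V W : rep_space R G) (f : V -> W) : Prop :=
  [/\ linear f, continuous f
    & forall g v, P g -> f (rep_act g v) = rep_act g (f v)].

Definition rep_iso (V W : rep_space R G) : Prop :=
  exists (f : V -> W) (f' : W -> V),
    [/\ rep_morphism f, rep_morphism f', cancel f f' & cancel f' f].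

End Representations.

Section CJ.
Variables (R : realType) (G : topGroupType) (n : nat) (rho : G -> 'M[R]_n.+1).

(* the quotient of V by a P-invariant subspace, with the action g.[v] = [g.v] *)
Definition quot_rep (V : rep_space R G) (S : submod V) : rep_space R G :=
  @RepSpace R G (qspace S) (fun g x => qproj S (rep_act g (qrepr x))).

(* the coordinatewise action on the inverse limit of the V / F k, for a
   filtration F by P-invariant subspaces; if g does not preserve F the value is
   junk *)
Definition lim_act (V : rep_space R G) (F : filtration V) (g : G)
    (x : invlim F) : invlim F :=
  match pselect (coherent (fun k => @rep_act _ _ (quot_rep (F k)) g (x k))) with
  | left gx => Invlim gx
  | right _ => x
  end.

Definition lim_rep (V : rep_space R G) (F : filtration V) : rep_space R G :=
  @RepSpace R G (invlim F) (@lim_act V F).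

Variable N : set G.

(* X.v = w, as a relation since the derivative need not exist in general *)
Definition lie_act (V : rep_space R G) (X : 'M[R]_n.+1) (v w : V) : Prop :=
  deriv0 (fun t : R => rep_act (gexp rho (t *: X)) v) w.

Fixpoint lie_monomials (V : rep_space R G) (k : nat) : set V :=
  if k is k'.+1 then
    [set w | exists2 X, LieAlg rho N X &
             exists2 v, @lie_monomials V k' v & lie_act X v w]
  else setT.
Arguments lie_monomials V k _ : clear implicits.

Definition npow (V : rep_space R G) (k : nat) : submod V :=
  span_submod (lie_monomials V k).

Lemma lie_monomials_dec (V : rep_space R G) j k : (j <= k)%N ->
  lie_monomials V k `<=` lie_monomials V j.
Proof.
elim: k j => [|k IHk] [|j]//= jk w [X nX [v Mv Xv]].
by exists X => //; exists v => //; exact: IHk Mv.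
Qed.

Lemma closure_npow_dec (V : rep_space R G) j k : (j <= k)%N ->
  closure_submod (npow V k) `<=` closure_submod (npow V j).
Proof.
move=> jk; apply: closureS; apply: span_set_min.
by apply: subset_trans (lie_monomials_dec jk) _; exact: sub_span_set.
Qed.

Definition npow_filtration (V : rep_space R G) : filtration V :=
  Filtration (@closure_npow_dec V).

Definition CJ (V : rep_space R G) : rep_space R G :=
  lim_rep (npow_filtration V).

Definition CJ_nat (V : rep_space R G) : V -> CJ V :=
  @lim_nat _ _ (npow_filtration V).

Definition CJs (V : rep_space R G) : submod V :=
  bigcap_submod (npow_filtration V).

(* F is CJ(f), i.e. it maps ([v_k])_k to ([f v_k])_k *)
Definition CJ_map (V W : rep_space R G) (f : V -> W) (F : CJ V -> CJ W) : Prop :=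
  forall (x : invlim (npow_filtration V)) k v, x k = qproj _ v ->
    (F x : invlim (npow_filtration W)) k = qproj _ (f v).

End CJ.

(* Main.v *)
Require Import Defs.
From mathcomp Require Import all_boot all_order all_algebra.
From mathcomp Require Import all_classical all_reals all_analysis.
From mathcomp Require Import complex ring lra.

Set Implicit Arguments.
Unset Strict Implicit.
Unset Printing Implicit Defensive.

Import Order.TTheory GRing.Theory Num.Theory.
Import numFieldNormedType.Exports.

Local Open Scope classical_set_scope.
Local Open Scope ring_scope.
Local Open Scope complex_scope.

(* Write F_k for the closure of n^k.pi.  The only analytic input is a density
   statement: for every continuous seminorm p there is k_0 such that F_(k+1) is
   p-dense in F_k for all k >= k_0.  A Mittag-Leffler argument then lifts every
   coherent family to pi with control of the seminorms, which gives both the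
   surjectivity of pi -> CJ(pi) and the continuity of the inverse of
   pi/CJ_s(pi) -> CJ(pi), so that the Frechet space CJ(pi) inherits smoothness
   and moderate growth from the quotient.

   For the density, let w = X_1 ... X_M v with X_i in n, and put
   gamma_i(t) = exp(t X_i).  Modulo F_(M+1) one has
   (gamma_1(t) - 1) ... (gamma_M(t) - 1) v = t^M w.  The left-hand side is a
   signed sum of 2^M vectors g v, where g is a product of some of the gamma_i(t).
   By Kolchin's theorem products of n+1 elements u - 1 with u in rho(N) vanish
   (for matrices of size n+1), so for integral t the entries of rho(g) grow at
   most like t^(n+1), whatever M is.  With moderate growth, the distance from
   t^M w to F_(M+1) for p is O(t^D) with D independent of M, so w lies in the
   p-closure of F_(M+1) as soon as M > D. *)

(** * Kolchin's theorem and growth of words in a unipotent group *)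

(** The degree D comes from the exponent r that moderate growth attaches to p, so k_0 depends on p
    and no single stage serves all seminorms; the lifting therefore uses a level K(m) for the m-th
    seminorm. Integral t suffices and makes words available: gamma(t) = gamma(1)^t is a product of t
    elements of one bounded set, and Kolchin's theorem turns a bound on the factors into a
    polynomial in their number. A separate obstacle is smoothness of the completed representation.
    The action is meaningful on P only, while smoothness is tested at exp(X + hY) with X, Y in
    Lie(P), and Lie(P) is defined as a set of velocities of one-parameter subgroups, so that its
    stability under sums is not given. As P is the normalizer of a subalgebra p, the membership of
    exp(X + hY) in P reduces to the invariance of p under a linear differential system, which a
    Gronwall estimate settles. *)

(** Induction on the size: a rank factorization A = C B gives tr A = tr (B C), and B C is nilpotent
    of size [\rank A]. Powers are written with [iter] so that the size may drop to any value, 0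
    included. *)
Lemma mxtrace_nilpotent (F : fieldType) (m : nat) (A : 'M[F]_m) (k : nat) :
  iter k (mulmx A) 1%:M = 0 -> \tr A = 0.
Proof.
elim/ltn_ind: m A k => m IHm A k Ak.
have [rm|] := ltnP (\rank A) m; last first.
  case: m A Ak {IHm} => [|m] A Ak rA; first by rewrite /mxtrace big_ord0.
  have uA : A \in unitmx by rewrite -row_full_unit /row_full eqn_leq rank_leq_row rA.
  have : iter k (mulmx A) 1%:M \in unitmx.
    by elim: k {Ak} => [|k IHk]/=; rewrite ?unitmx1// unitmx_mul uA.
  by rewrite Ak unitmxE det0 unitr0.
have iterM r (B : 'M[F]_(m, r)) (C : 'M[F]_(r, m)) j :
    iter j.+1 (mulmx (C *m B)) 1%:M = C *m iter j (mulmx (B *m C)) 1%:M *m B.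
  elim: j => [|j IHj]; first by rewrite /= !mulmx1.
  by rewrite iterS IHj /= !mulmxA.
rewrite -[A]mulmx_base mxtrace_mulC; apply: (IHm _ rm _ k.+1).
by rewrite iterM mulmx_base Ak mulmx0 mul0mx.
Qed.

Lemma mxtrace_idempotent (F : fieldType) (m : nat) (E : 'M[F]_m) :
  E *m E = E -> \tr E = (\rank E)%:R.
Proof.
move=> EE; rewrite -[in LHS](mulmx_base E) mxtrace_mulC.
suff -> : row_base E *m col_base E = 1%:M by rewrite mxtrace1.
have h : col_base E *m (row_base E *m col_base E) *m row_base E =
    col_base E *m 1%:M *m row_base E.
  by rewrite mulmx1 mulmxA mulmx_base -mulmxA mulmx_base EE.
exact/(row_full_inj (col_base_full E))/(row_free_inj (row_base_free E)).
Qed.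

(** Write the characteristic polynomial as X^j q with q(0) nonzero, and u X^(j+1) + v q = 1. Then (u
    X^(j+1))(A) is the projector onto the part where A is invertible; its trace is both 0 and its
    rank, so it vanishes in characteristic 0. *)
Lemma nilpotent_of_mxtrace (F : numFieldType) (n : nat) (A : 'M[F]_n.+1) :
  (forall k, \tr (A ^+ k.+1) = 0) -> exists k, A ^+ k = 0.
Proof.
move=> trA.
have trX (w : {poly F}) : \tr (horner_mx A ('X * w)) = 0.
  rewrite -[w]coefK poly_def mulr_sumr !raddf_sum big1//= => i _.
  by rewrite -scalerAr -exprS linearZ /= linearZ /= rmorphXn /= horner_mx_X trA mulr0.
have [j [q]] := multiplicity_XsubC (char_poly A) 0.
rewrite monic_neq0 ?char_poly_monic//= subr0 => q0 pE.
(* With j + 1 instead of j, the projector is a multiple of A even when j = 0, as [trX] requires. *)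
have : coprimep ('X ^+ j.+1) q.
  by rewrite coprimep_expl// coprimep_sym coprimepX.
move=> /Bezout_eq1_coprimepP[[u v] /= uv].
have AN : horner_mx A (q * 'X ^+ j.+1) = 0.
  by rewrite exprSr mulrA -pE rmorphM /= Cayley_Hamilton mul0r.
set e := horner_mx A (u * 'X ^+ j.+1).
have ee : e *m e = e.
  rewrite -[RHS]mulr1 -[1 in RHS](rmorph1 (horner_mx A)) -uv rmorphD mulrDr.
  rewrite -[X in _ = _ + X]rmorphM /=.
  have -> : u * 'X ^+ j.+1 * (v * q) = u * v * (q * 'X ^+ j.+1) by ring.
  by rewrite [X in _ = _ + X]rmorphM /= AN mulr0 addr0.
have /eqP : \tr e = 0 by rewrite /e exprS mulrCA trX.
rewrite mxtrace_idempotent// pnatr_eq0 mxrank_eq0 => /eqP e0.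
exists j.+1; have := AN; rewrite rmorphM /= rmorphXn /= horner_mx_X => qA.
have : horner_mx A v * horner_mx A q = 1.
  by rewrite -rmorphM /= -[RHS](rmorph1 (horner_mx A)) -uv rmorphD /= -/e e0 add0r.
by move=> /(congr1 (fun B => B * A ^+ j.+1)); rewrite mul1r -mulrA qA mulr0.
Qed.

(** Gives access to ranks and dimension counts for subspaces that are mere predicates: B is a matrix
    of maximal rank whose row space lies in S. *)
Lemma subspace_mx (F : fieldType) (m : nat) (S : set 'rV[F]_m) :
  subspace_set S -> exists B : 'M[F]_m, forall x, S x <-> (x <= B)%MS.
Proof.
move=> SS; pose S' := Submod SS.
pose Q r := `[< exists2 B : 'M[F]_m, forall x, (x <= B)%MS -> S x & \rank B = r >].
have exQ : exists r, Q r.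
  exists 0%N; apply/asboolP; exists 0; last by rewrite mxrank0.
  by move=> x; rewrite submx0 => /eqP ->; exact: (submod0 S').
have ubQ r : Q r -> (r <= m)%N by move=> /asboolP[B _ <-]; exact: rank_leq_row.
case: (ex_maxnP exQ ubQ) => r /asboolP[B BS Br] rmax.
exists B => x; split=> [Sx|]; last exact: BS.
have : Q (\rank (B + x)%MS).
  apply/asboolP; exists (B + x)%MS => // y /sub_addsmxP[[u v] /= ->].
  apply: (submodD (S := S')); first by apply: BS; exact: submxMl.
  by rewrite [v]mx11_scalar mul_scalar_mx; exact: (submodZ (S := S')).
move/rmax; rewrite -Br => le.
have := mxrank_leqif_sup (addsmxSl B x); move=> /leqifP; case: ifP => // [H _|_].
  exact: submx_trans (addsmxSr _ _) H.
by rewrite ltnNge le.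
Qed.

(** The row vectors killed by d factors form an ascending series that starts with 0 and the common
    fixed vectors. Several rows are allowed so that x can be the identity matrix. *)
Fixpoint kills (F : fieldType) (n : nat) (U : set 'M[F]_n.+1) (d m : nat)
    (x : 'M[F]_(m, n.+1)) : Prop :=
  if d is d'.+1 then forall u, U u -> kills U d' (x *m (u - 1)) else x = 0.

Lemma kills_subspace (F : fieldType) n (U : set 'M[F]_n.+1) d m :
  subspace_set [set x : 'M[F]_(m, n.+1) | kills U d x].
Proof.
elim: d => [|d [IH0 IHD]]; split=> //=.
- by move=> a u v -> ->; rewrite scaler0 addr0.
- by move=> u _; rewrite mul0mx; exact: IH0.
- move=> a x y kx ky u Uu; rewrite mulmxDl -scalemxAl.
  by apply: IHD; [exact: kx|exact: ky].
Qed.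

Lemma killsS (F : fieldType) n (U : set 'M[F]_n.+1) d m (x : 'M[F]_(m, n.+1)) :
  kills U d x -> kills U d.+1 x.
Proof.
elim: d x => [|d IH] x /= => [-> u _|kx u Uu v Uv]; first by rewrite mul0mx.
exact: (IH _ (kx _ Uu)).
Qed.

Section Kolchin.
Variables (F : numFieldType) (n : nat) (U : set 'M[F]_n.+1).
Hypothesis UM : forall A B, U A -> U B -> U (A * B).
Hypothesis Uunip : U `<=` @unipotent F n.

(** The image of the augmentation ideal. Its elements have trace 0 and it is stable under products,
    so the trace criterion upgrades unipotence of the single u to nilpotence of every linear
    combination of the u - 1. *)
Let J : submod _ := span_submod [set u - 1 | u in U].

Lemma augmentation_mul a b : J a -> J b -> J (a * b).
Proof.
move=> Ja; have subl : subspace_set [set b | J (a * b)].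
  split=> [|c x y Jx Jy] /=; first by rewrite mulr0; exact: (submod0 J).
  by rewrite mulrDr -scalerAr; exact: (submodZD (S := J)).
move: b; apply: (@span_set_min _ _ _ (Submod subl)) => _ [v Uv <-] /=.
have subr : subspace_set [set a | J (a * (v - 1))].
  split=> [|c x y Jx Jy] /=; first by rewrite mul0r; exact: (submod0 J).
  by rewrite mulrDl -scalerAl; exact: (submodZD (S := J)).
move: a Ja {subl}; apply: (@span_set_min _ _ _ (Submod subr)) => _ [u Uu <-] /=.
have Jx x : U x -> J (x - 1) by move=> Ux; apply: sub_span_set; exists x.
have -> : (u - 1) * (v - 1) = (u * v - 1) + (- (u - 1) + - (v - 1)).
  rewrite mulrBl mulrBr mul1r mulr1 addrA; congr (_ + _).
  by rewrite opprB [RHS]addrA subrK.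
by apply: (submodD (S := J)); [by apply: Jx; exact: UM|apply: (submodD (S := J));
  apply: (submodN (S := J)); exact: Jx].
Qed.

Lemma augmentation_nilpotent a : J a -> exists k, a ^+ k = 0.
Proof.
move=> Ja; apply: nilpotent_of_mxtrace => k.
have : J (a ^+ k.+1).
  by elim: k => [|k IH]; rewrite ?expr1// exprS; exact: augmentation_mul.
have sub0 : subspace_set [set a : 'M[F]_n.+1 | \tr a = 0].
  split=> [|c x y /= tx ty]; first exact: mxtrace0.
  by rewrite linearP /= tx ty mulr0 addr0.
move: (a ^+ k.+1); apply: (@span_set_min _ _ _ (Submod sub0)) => _ [u Uu <-] /=.
have [j uj] := Uunip Uu; apply: (mxtrace_nilpotent (k := j)).
by rewrite -{}uj; elim: j => // j /= ->; rewrite exprS.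
Qed.

Lemma kills_augmentation d x a : @kills F n U d 1 x -> J a -> kills U d (x *m a).
Proof.
move=> kx; have sub : subspace_set [set a : 'M[F]_n.+1 | kills U d (x *m a)].
  have [k0 kD] := kills_subspace U d 1.
  split=> [|c y z /= ky kz]; first by rewrite /= mulmx0.
  by rewrite mulmxDr -scalemxAr; exact: kD.
move: a; apply: (@span_set_min _ _ _ (Submod sub)) => _ [u Uu <-] /=.
exact: killsS.
Qed.

(* T is minimal among the J-stable subspaces strictly containing the subspace W
   of vectors killed by d factors.  If x is in T but not in W, then either x J
   lies in W, or W + x J = T contains x, so that x = w + x a with a in J
   nilpotent and x lies in W, a contradiction. *)
Lemma kills_grow d : ~ (forall x : 'rV_n.+1, kills U d x) ->
  exists2 x : 'rV_n.+1, kills U d.+1 x & ~ kills U d x.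
Proof.
move=> nfull; have [B BP] := subspace_mx (kills_subspace U d 1).
pose Q r := `[< exists2 T : 'M[F]_n.+1, [/\ (B <= T)%MS, ~~ (T <= B)%MS &
   forall (x : 'rV_n.+1) a, (x <= T)%MS -> J a -> (x *m a <= T)%MS] & \rank T = r >].
have exQ : exists r, Q r.
  exists n.+1; apply/asboolP; exists 1%:M; last by rewrite mxrank1.
  split; [exact: submx1| |by move=> *; exact: submx1].
  apply/negP => B1; apply: nfull => x; apply/BP.
  exact: submx_trans (submx1 _) B1.
case: (ex_minnP exQ) => r /asboolP[T [BT nTB TJ] Tr] rmin.
have [i xB] := row_subPn nTB; set x := row i T in xB.
have xT : (x <= T)%MS by exact: row_sub.
have nkx : ~ kills U d x by move=> /BP; exact/negP.
exists x => //= u Uu; apply: contrapT => nxu.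
have subS : subspace_set
    [set y : 'rV_n.+1 | exists w a, [/\ (w <= B)%MS, J a & y = w + x *m a]].
  split=> [|c _ _ [w [a [wB Ja ->]]] [w' [a' [wB' Ja' ->]]]].
    by exists 0, 0; split; [exact: sub0mx|exact: (submod0 J)|rewrite mulmx0 addr0].
  exists (c *: w + w'), (c *: a + a'); split.
  - by rewrite addmx_sub// scalemx_sub.
  - exact: (submodZD (S := J)).
  - by rewrite mulmxDr -scalemxAr scalerDr addrACA.
have [S SP] := subspace_mx subS.
have ST : (S <= T)%MS.
  apply/rV_subP => y /SP[w [a [wB Ja ->]]].
  by rewrite addmx_sub ?TJ// (submx_trans wB).
have BS : (B <= S)%MS.
  apply/rV_subP => y yB; apply/SP; exists y, 0.
  by split=> //; [exact: (submod0 J)|rewrite mulmx0 addr0].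
have nSB : ~~ (S <= B)%MS.
  apply/negP => SB; apply/nxu/BP; apply: submx_trans SB; apply/SP.
  exists 0, (u - 1); split; [exact: sub0mx| |by rewrite add0r].
  by apply: sub_span_set; exists u.
have : Q (\rank S).
  apply/asboolP; exists S => //; split=> // y b /SP[w [a [wB Ja ->]]] Jb; apply/SP.
  exists (w *m b), (a * b); split.
  - by apply/BP/kills_augmentation => //; exact/BP.
  - exact: augmentation_mul.
  - by rewrite mulmxDl mulmxA.
move=> /rmin; rewrite -Tr => rTS.
have TS : (T <= S)%MS.
  have := mxrank_leqif_sup ST; move=> /leqifP; case: ifP => // _.
  by rewrite ltnNge rTS.
have /SP[w [a [wB Ja xE]]] := submx_trans xT TS.
have [k ak] := augmentation_nilpotent Ja.
have : exists2 w' : 'rV_n.+1, (w' <= B)%MS & x = w' + x *m a ^+ k.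
  elim: k {ak} => [|k [w' wB' xE']].
    by exists 0; [exact: sub0mx|rewrite expr0 mulmx1 add0r].
  exists (w + w' *m a).
    by rewrite addmx_sub//; apply/BP/kills_augmentation => //; exact/BP.
  by rewrite {1}xE -addrA; congr (_ + _); rewrite {1}xE' mulmxDl exprSr mulmxA.
by move=> [w' wB']; rewrite ak mulmx0 addr0 => xw; apply/nkx/BP; rewrite xw.
Qed.

(** Each step of the series gains a dimension until the whole space is reached, so n+1 steps are
    enough. *)
Theorem kolchin m (x : 'M[F]_(m, n.+1)) : kills U n.+1 x.
Proof.
suff H (y : 'rV[F]_n.+1) : kills U n.+1 y.
  have row_kills d : (forall i, kills U d (row i x)) -> kills U d x.
    elim: d x => [|d IH] y /= ky.
      by apply/row_matrixP => i; rewrite ky row0.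
    by move=> u Uu; apply: IH => i; rewrite row_mul; exact: ky.
  exact: row_kills.
have rk d : (forall y : 'rV[F]_n.+1, kills U d y) \/
    (forall B : 'M[F]_n.+1, (forall y : 'rV_n.+1, kills U d y <-> (y <= B)%MS) ->
      (d <= \rank B)%N).
  elim: d => [|d [IH|IH]]; first by right.
    by left=> z; exact/killsS/IH.
  have [full|/kills_grow[z kz nkz]] := pselect (forall y : 'rV_n.+1, kills U d y).
    by left=> z; exact/killsS/full.
  right=> B BP; have [C CP] := subspace_mx (kills_subspace U d 1).
  apply: leq_ltn_trans (IH C CP) _.
  have : (C < B)%MS; last by rewrite ltmxErank => /andP[].
  rewrite ltmxE; apply/andP; split.
    by apply/rV_subP => v /CP/killsS/BP.
  by apply/negP => BC; apply/nkz/CP; apply: submx_trans BC; exact/BP.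
have [//|full] := rk n.+1.
have [B BP] := subspace_mx (kills_subspace U n.+1 1).
by apply/BP/submx_full; rewrite /row_full eqn_leq rank_leq_row full.
Qed.
End Kolchin.

(** * Polynomial growth of products of unipotent matrices *)

Section Growth.
Variable F : realFieldType.

Definition mxnorm1 m n (A : 'M[F]_(m, n)) : F := \sum_i \sum_j `|A i j|.

Lemma mxnorm1_ge0 m n (A : 'M[F]_(m, n)) : 0 <= mxnorm1 A.
Proof. by apply: sumr_ge0 => i _; apply: sumr_ge0. Qed.

Lemma mxnorm1D m n (A B : 'M[F]_(m, n)) : mxnorm1 (A + B) <= mxnorm1 A + mxnorm1 B.
Proof.
rewrite -big_split /=; apply: ler_sum => i _.
by rewrite -big_split /=; apply: ler_sum => j _; rewrite mxE ler_normD.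
Qed.

Lemma mxnorm1M m n p (A : 'M[F]_(m, n)) (B : 'M[F]_(n, p)) :
  mxnorm1 (A *m B) <= mxnorm1 A * mxnorm1 B.
Proof.
rewrite mulr_suml; apply: ler_sum => i _.
apply: (@le_trans _ _ (\sum_j \sum_k `|A i k| * `|B k j|)).
  apply: ler_sum => j _; rewrite mxE (le_trans (ler_norm_sum _ _ _))//.
  by apply: ler_sum => k _; rewrite normrM.
rewrite exchange_big /= mulr_suml; apply: ler_sum => k _.
rewrite -mulr_sumr ler_wpM2l// /mxnorm1 (bigD1 k)//= lerDl.
by apply: sumr_ge0 => l _; apply: sumr_ge0.
Qed.

(** Peeling off the first factor as u = 1 + (u - 1) either shortens the word with d unchanged, or
    shortens it and lowers d; the degree of the bound is thus d whatever the length. *)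
Lemma kills_growth n (U : set 'M[F]_n.+1) (C : F) (ws : seq 'M[F]_n.+1) d m
    (x : 'M[F]_(m, n.+1)) : 0 <= C ->
  (forall u, u \in ws -> U u /\ mxnorm1 (u - 1) <= C) -> kills U d x ->
  mxnorm1 (x *m \prod_(u <- ws) u) <= mxnorm1 x * (1 + C * (size ws)%:R) ^+ d.
Proof.
move=> C0; have pos k : 0 <= 1 + C * k%:R by rewrite addr_ge0// mulr_ge0.
elim: ws d x => [|u ws IH] d x wsP kx.
  by rewrite big_nil mulmx1 /= mulr0 addr0 expr1n mulr1.
have wsP' v : v \in ws -> U v /\ mxnorm1 (v - 1) <= C.
  by move=> vws; apply: wsP; rewrite inE vws orbT.
have {}IH d' y := IH d' y wsP'.
have [Uu uC] := wsP u (mem_head _ _).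
case: d kx => [/= ->|d kx].
  by rewrite mul0mx expr0 mulr1.
have kxu : kills U d (x *m (u - 1)) by exact: kx.
have -> : x *m \prod_(v <- u :: ws) v =
    x *m \prod_(v <- ws) v + (x *m (u - 1)) *m \prod_(v <- ws) v.
  by rewrite -mulmxDl -{2}[x]mulmx1 -mulmxDr addrC subrK big_cons mulmxA.
apply: le_trans (mxnorm1D _ _) _.
apply: le_trans (lerD (IH _ _ kx) (IH _ _ kxu)) _.
have le1 : mxnorm1 (x *m (u - 1)) <= mxnorm1 x * C.
  by apply: le_trans (mxnorm1M _ _) _; rewrite ler_wpM2l// mxnorm1_ge0.
apply: (@le_trans _ _ (mxnorm1 x * (1 + C * (size ws)%:R) ^+ d.+1 +
    mxnorm1 x * C * (1 + C * (size ws)%:R) ^+ d)).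
  by rewrite lerD2l ler_wpM2r// exprn_ge0.
(* With y = 1 + C l, this is y^(d+1) + C y^d = y^d (y + C) <= (y + C)^(d+1), where y + C belongs to
   length l + 1. *)
rewrite -mulrA -mulrDr ler_wpM2l ?mxnorm1_ge0// exprS -mulrDl.
rewrite exprS ler_pM//; first by rewrite addr_ge0.
  by rewrite exprn_ge0.
  by rewrite -addrA -[X in _ + (_ + X)]mulr1 -mulrDr natr1.
by rewrite lerXn2r ?nnegrE// lerD2l ler_wpM2l// ler_nat.
Qed.
End Growth.

(** * One-parameter subgroups *)

Section MatrixCurves.
Variables (R : realType) (m : nat).
Implicit Types (A B : R -> 'M[R]_m.+1).

Lemma is_derive_mxP (M : R -> 'M[R]_m.+1) (t : R) (X : 'M[R]_m.+1) :
  is_derive t (1 : R) M X <->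
  forall i j, is_derive t (1 : R) (fun x => M x i j) (X i j).
Proof.
split=> [[dM dX] i j|H].
  split; first by move/derivable_mxP: dM; apply.
  by rewrite -dX (derive_mx dM) mxE.
have dM : derivable M t 1 by apply/derivable_mxP => i j; case: (H i j).
split=> //; rewrite (derive_mx dM); apply/matrixP => i j.
by rewrite mxE; case: (H i j).
Qed.

Lemma is_derive_mulmx A B t X Y :
  is_derive t (1 : R) A X -> is_derive t (1 : R) B Y ->
  is_derive t (1 : R) (fun x => A x * B x) (X * B t + A t * Y).
Proof.
move=> /is_derive_mxP dA /is_derive_mxP dB; apply/is_derive_mxP => i j.
have -> : (fun x => (A x * B x) i j) = \sum_k ((fun x => A x i k) * (fun x => B x k j)).
  by apply/funext => x; rewrite mxE fct_sumE; apply: eq_bigr.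
have -> : (X * B t + A t * Y) i j = \sum_k (A t i k *: Y k j + B t k j *: X i k).
  rewrite !mxE -big_split /=; apply: eq_bigr => k _.
  by rewrite addrC [_ *: X i k]mulrC.
apply: is_derive_sum => k; exact: is_deriveM.
Qed.

Lemma is_derive_cst_mx (C : 'M[R]_m.+1) (t : R) : is_derive t (1 : R) (fun=> C) 0.
Proof. exact: is_derive_cst. Qed.

Lemma is_derive0_mx A X : (forall t, is_derive t (1 : R) A 0) -> A X = A 0.
Proof.
move=> dA; apply/matrixP => i j; apply: (@is_derive_0_is_cst _ (fun x => A x i j)) => t.
by have /is_derive_mxP/(_ i j) := dA t; rewrite mxE.
Qed.

Lemma is_derive_shift A (a t : R) X : is_derive (a + t) (1 : R) A X ->
  is_derive t (1 : R) (fun x => A (a + x)) X.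
Proof.
move=> /is_derive_mxP dA; apply/is_derive_mxP => i j.
have da : is_derive t (1 : R) (fun x => a + x) 1.
  by rewrite -[X in is_derive _ _ _ X]add0r; exact: is_deriveD.
have := @is_derive1_comp _ (fun x => A x i j) _ t _ _ (dA i j) da.
by rewrite mulr1.
Qed.

Lemma is_derive_scale A (a t : R) X : is_derive (a * t) (1 : R) A X ->
  is_derive t (1 : R) (fun x => A (a * x)) (a *: X).
Proof.
move=> /is_derive_mxP dA; apply/is_derive_mxP => i j.
have da : is_derive t (1 : R) (fun x => a * x) a.
  by rewrite -[X in is_derive _ _ _ X]mulr1; exact: is_deriveZ.
have := @is_derive1_comp _ (fun x => A x i j) _ t _ _ (dA i j) da.
by rewrite mxE mulrC.
Qed.

End MatrixCurves.

Section OneParam.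
Variables (R : realType) (G : topGroupType) (n : nat) (rho : G -> 'M[R]_n.+1).
Hypothesis G_hausdorff : hausdorff_space G.
Hypothesis rho1 : rho 1%g = 1.
Hypothesis rhoM : forall g h, rho (g * h)%g = rho g * rho h.
Hypothesis ker_finite : finite_set [set g | rho g = 1].

Lemma rhoV g : rho g * rho g^-1%g = 1.
Proof. by rewrite -rhoM mulgV rho1. Qed.

Lemma rhoVE g : rho g^-1%g = (rho g)^-1.
Proof.
have ug : rho g \is a GRing.unit.
  by apply/unitrP; exists (rho g^-1%g); rewrite -!rhoM mulgV mulVg rho1.
by apply: (mulrI ug); rewrite rhoV divrr.
Qed.

Lemma one_param0 X gamma : one_param rho X gamma -> gamma 0 = 1%g.
Proof.
move=> [_ gD _]; have /(congr1 (fun g => (g * (gamma 0)^-1)%g)) := gD 0 0.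
by rewrite addr0 mulgK mulgV.
Qed.

Lemma one_paramN X gamma t : one_param rho X gamma -> gamma (- t) = (gamma t)^-1%g.
Proof.
move=> oX; case: (oX) => _ gD _; apply: (mulgI (gamma t)).
by rewrite -gD subrr mulgV (one_param0 oX).
Qed.

(** Both placements of X are recorded: in the product rule below, the right-hand form of one factor
    cancels the left-hand form of the other. *)
Lemma one_param_deriv X gamma t : one_param rho X gamma ->
  is_derive t (1 : R) (rho \o gamma) (X * rho (gamma t)) /\
  is_derive t (1 : R) (rho \o gamma) (rho (gamma t) * X).
Proof.
move=> oX; case: (oX) => _ gD dX.
have dX' : is_derive (- t + t) (1 : R) (rho \o gamma) X by rewrite addNr.
have := is_derive_shift dX'; split.
  have -> : rho \o gamma = fun x => rho (gamma (- t + x)) * rho (gamma t).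
    by apply/funext => x; rewrite -rhoM -gD addrAC addNr add0r.
  have := is_derive_mulmx (is_derive_shift dX') (is_derive_cst_mx (rho (gamma t)) t).
  by rewrite mulr0 addr0.
have -> : rho \o gamma = fun x => rho (gamma t) * rho (gamma (- t + x)).
  by apply/funext => x; rewrite -rhoM -gD addrA subrr add0r.
have := is_derive_mulmx (is_derive_cst_mx (rho (gamma t)) t) (is_derive_shift dX').
by rewrite mul0r add0r.
Qed.

Lemma one_param_derivN X gamma t : one_param rho X gamma ->
  is_derive t (1 : R) (fun x => rho (gamma (- x))) (- (X * rho (gamma (- t)))).
Proof.
move=> oX; have [+ _] := one_param_deriv (- t) oX; rewrite -[- t]mulN1r.
move/is_derive_scale; rewrite scaleN1r.
by under [fun x => _ in X in X -> _]eq_fun do rewrite /= mulN1r.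
Qed.

Lemma one_param_rho_uniq X g1 g2 t : one_param rho X g1 -> one_param rho X g2 ->
  rho (g1 t) = rho (g2 t).
Proof.
move=> o1 o2; pose C x := rho (g1 x) * rho (g2 (- x)).
have : C t = C 0.
  apply: is_derive0_mx => x.
  have := is_derive_mulmx (one_param_deriv x o1).2 (one_param_derivN x o2).
  by rewrite mulrN mulrA subrr.
rewrite /C oppr0 (one_param0 o1) (one_param0 o2) rho1 mulr1 (one_paramN _ o2).
move=> /(congr1 (fun A => A * rho (g2 t))).
by rewrite -mulrA -rhoM mulVg rho1 mulr1 mul1r.
Qed.

(** [rho] determines the curve up to its kernel. The quotient of two solutions is a continuous path
    in a finite subset of a Hausdorff group, hence constant. This makes [gexp] independent of the
    choice made by [xget]. *)
Lemma one_param_uniq X g1 g2 t : one_param rho X g1 -> one_param rho X g2 ->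
  g1 t = g2 t.
Proof.
move=> o1 o2; pose z x := (g1 x * (g2 x)^-1)%g.
have cz : continuous z.
  move=> x; apply: (@continuous_comp _ _ _ (fun x => (g1 x, (g2 x)^-1%g))
    (fun z : G * G => (z.1 * z.2)%g)); last exact: mulg_continuous.
  apply: cvg_pair; first by case: o1 => c1 _ _; exact: c1.
  apply: (@continuous_comp _ _ _ g2 (fun g => g^-1%g)); last exact: invg_continuous.
  by case: o2 => c2 _ _; exact: c2.
have zker x : rho (z x) = 1.
  by rewrite rhoM (one_param_rho_uniq x o1 o2) rhoV.
have fcl (A : set G) : finite_set A -> closed A.
  exact: (accessible_finite_set_closed.1 (hausdorff_accessible G_hausdorff)).
have : [set x | z x = 1%g] = setT.
  have /connected_intervalP con : is_interval [set: R] by [].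
  apply: con.
  - by exists 0; rewrite /= /z (one_param0 o1) (one_param0 o2) mulgV.
  - exists (z @^-1` ~` ([set g | rho g = 1] `\ 1%g)).
      apply: open_comp; first by move=> *; exact: cz.
      apply: closed_openC; apply: fcl; exact: finite_setD.
    rewrite setTI; apply/seteqP; split=> x /=; first by move=> -> [_]; apply.
    by move=> H; apply: contrapT => zx; apply: H.
  - exists (z @^-1` [set 1%g]); last by rewrite setTI.
    apply: (proj1 (continuous_closedP _) cz); apply: fcl; exact: finite_set1.
move/seteqP => [_ /(_ t I) /= /(congr1 (fun g => (g * g2 t)%g))].
by rewrite mulgVK mul1g.
Qed.

Lemma one_param_scale X gamma (a : R) : one_param rho X gamma ->
  one_param rho (a *: X) (fun t => gamma (a * t)).
Proof.
move=> oX; case: (oX) => c gD dX; split.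
- move=> x; apply: (@continuous_comp _ _ _ (fun t => a * t) gamma); last exact: c.
  exact: mulrl_continuous.
- by move=> s t; rewrite mulrDr gD.
- by apply: (@is_derive_scale _ _ (rho \o gamma)); rewrite mulr0.
Qed.

Lemma gexpE X gamma : one_param rho X gamma -> gexp rho X = gamma 1.
Proof.
move=> oX; rewrite /gexp; case: xgetP => [g _ [g' o' <-]|/(_ (gamma 1))].
  exact: one_param_uniq o' oX.
by move=> H; exfalso; apply: H; exists gamma.
Qed.

Lemma gexp_scale X gamma t : one_param rho X gamma -> gexp rho (t *: X) = gamma t.
Proof. by move=> /(one_param_scale t) /gexpE ->; rewrite mulr1. Qed.

Lemma one_param_conj X gamma g : one_param rho X gamma ->
  one_param rho (rho g * X * (rho g)^-1) (fun t => g * gamma t * g^-1)%g.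
Proof.
move=> oX; case: (oX) => c gD dX; split.
- move=> x; apply: (@continuous_comp _ _ _ (fun t => (g * gamma t, g^-1)%g)
    (fun z : G * G => (z.1 * z.2)%g)); last exact: mulg_continuous.
  apply: cvg_pair; last exact: cvg_cst.
  apply: (@continuous_comp _ _ _ (fun t => (g, gamma t))
    (fun z : G * G => (z.1 * z.2)%g)); last exact: mulg_continuous.
  by apply: cvg_pair; [exact: cvg_cst|exact: c].
- by move=> s t; rewrite gD -!mulgA; congr (_ * (_ * _))%g; rewrite mulgA mulVg mul1g.
- have -> : rho \o (fun t => g * gamma t * g^-1)%g = fun t => rho g * rho (gamma t) * (rho g)^-1.
    by apply/funext => t; rewrite /= !rhoM rhoVE.
  have := is_derive_mulmx (is_derive_mulmx (is_derive_cst_mx (rho g) 0) dX)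
    (is_derive_cst_mx (rho g)^-1 0).
  by rewrite mul0r add0r mulr0 addr0.
Qed.

Lemma one_param_cst : one_param rho 0 (fun=> 1%g).
Proof.
split; [exact: cst_continuous|by move=> *; rewrite mulg1|].
exact: is_derive_cst.
Qed.

End OneParam.

(** * Seminorms and distances to subspaces *)

Section Seminorms.
Variables (R : realType) (V : topologicalLmodType R[i]).
Implicit Types (p : V -> R) (S : submod V).

Lemma Re_norm_real (a : R) : complex.Re `|a%:C| = `|a|.
Proof. by rewrite normc_def /= expr0n addr0 sqrtr_sqr. Qed.

Lemma seminormZ p (a : R) v : seminorm p -> p (a%:C *: v) = `|a| * p v.
Proof. by move=> [_ ->]; rewrite Re_norm_real. Qed.

Lemma seminorm0 p : seminorm p -> p 0 = 0.
Proof. by move=> sp; rewrite -(scale0r 0) -[0 : R[i]]/(0%:C) seminormZ// normr0 mul0r. Qed.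

Lemma seminormN p v : seminorm p -> p (- v) = p v.
Proof.
by move=> sp; rewrite -scaleN1r -[- 1]/((-1) : R[i]) sp.2 normrN1 mul1r.
Qed.

Lemma seminorm_ge0 p v : seminorm p -> 0 <= p v.
Proof.
move=> sp; have := sp.1 v (- v); rewrite subrr seminorm0// seminormN//.
by rewrite -mulr2n pmulrn_lge0.
Qed.

Lemma seminormB p u v : seminorm p -> p (u - v) <= p u + p v.
Proof. by move=> sp; rewrite -(seminormN v sp); exact: sp.1. Qed.

Lemma seminormBC p u v : seminorm p -> p (u - v) = p (v - u).
Proof. by move=> sp; rewrite -seminormN// opprB. Qed.

Lemma seminorm_dist p u v : seminorm p -> `|p u - p v| <= p (u - v).
Proof.
move=> sp; have h1 := sp.1 (u - v) v; have h2 := sp.1 (v - u) u.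
rewrite !subrK in h1 h2; rewrite ler_norml; move: h2; rewrite (seminormBC v u sp) => h2.
by apply/andP; split; lra.
Qed.

Lemma nbhs_addr v (U : set V) : nbhs v U <-> nbhs 0 [set u | U (v + u)].
Proof.
have shift (a b : V) (W : set V) : nbhs (a + b) W -> nbhs b [set u | W (a + u)].
  move=> /(@add_continuous V (a, b)) [[A B]/= [nA nB] AB].
  apply: filterS nB => u Bu; apply: (AB (a, u)); split=> //=.
  exact: nbhs_singleton.
split=> [nU|/= nU]; first by apply: shift; rewrite addr0.
have := shift (- v) v [set u | U (v + u)]; rewrite addNr => /(_ nU).
by apply: filterS => u /=; rewrite addrA subrr add0r.
Qed.

Lemma seminorm_continuous p : seminorm p ->
  (forall e : R, 0 < e -> nbhs 0 [set v | p v < e]) -> continuous p.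
Proof.
move=> sp np v; apply/cvgrPdist_lt => e e0; apply/nbhs_addr.
apply: filterS (np e e0) => u /= ue; apply: le_lt_trans (seminorm_dist _ _ sp) _.
by rewrite opprD addrA subrr add0r seminormN.
Qed.

Lemma continuous_seminorm_nbhs p v (e : R) : continuous_seminorm p -> 0 < e ->
  nbhs v [set u | p (u - v) < e].
Proof.
move=> [sp cp] e0; apply/nbhs_addr.
have /cvgrPdist_lt/(_ _ e0) := cp 0; apply: filterS => u /=.
by rewrite seminorm0// sub0r normrN addrC addKr ger0_norm// seminorm_ge0.
Qed.

(** An increasing system of seminorms, so that one seminorm and one radius test a neighbourhood of 0
    in place of the finite intersections in [frechet]. *)
Definition graded (P : nat -> V -> R) : Prop :=
  [/\ forall m, seminorm (P m),
      forall j k v, (j <= k)%N -> P j v <= P k v,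
      forall v, (forall m, P m v = 0) -> v = 0
    & forall U : set V, nbhs 0 U <->
        exists m (e : R), 0 < e /\ [set v | P m v < e] `<=` U].

Definition seq_complete : Prop := forall u : nat -> V,
  (forall U : set V, nbhs 0 U -> exists m, forall i j,
     (m <= i)%N -> (m <= j)%N -> U (u i - u j)) ->
  exists l : V, u @ \oo --> l.

Lemma graded_continuous P m : graded P -> continuous_seminorm (P m).
Proof.
move=> [sP _ _ nP]; split=> //; apply: seminorm_continuous => // e e0.
by apply/nP; exists m, e; split.
Qed.

Lemma frechet_graded : frechet V <-> (exists P, graded P) /\ seq_complete.
Proof.
split=> -[[p gp] cV]; split=> //.
  case: gp => sp p0 np.
  have sS m : seminorm (fun v => \sum_(i < m) p i v).
    split=> [u v|a v].
      by rewrite -big_split /=; apply: ler_sum => i _; exact: (sp i).1.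
    by rewrite mulr_sumr; apply: eq_bigr => i _; exact: (sp i).2.
  have leS m i v : (i < m)%N -> p i v <= \sum_(i < m) p i v.
    move=> im; rewrite (bigD1 (Ordinal im))//= lerDl sumr_ge0// => k _.
    exact: seminorm_ge0.
  exists (fun m v => \sum_(i < m) p i v); split=> //.
  - move=> j k v jk; rewrite -!(big_mkord xpredT (fun i => p i v)).
    rewrite (big_cat_nat (leq0n j) jk)/= lerDl sumr_ge0// => i _; exact: seminorm_ge0.
  - move=> v v0; apply: p0 => i; apply/eqP; rewrite eq_le seminorm_ge0// andbT.
    by rewrite -(v0 i.+1); exact: leS.
  - move=> U; split=> [/np[m [e [e0 eU]]]|[m [e [e0 eU]]]].
      exists m, e; split=> // v /= ve; apply: eU => i im.
      exact: le_lt_trans (leS _ _ _ im) ve.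
    (* Dividing by m + 1 keeps the sum of m terms strictly below e, also for m = 0. *)
    apply/np; exists m, (e / m.+1%:R); split; first by rewrite divr_gt0.
    move=> v ve; apply: eU => /=.
    apply: (@le_lt_trans _ _ (\sum_(i < m) (e / m.+1%:R))).
      by apply: ler_sum => i _; apply/ltW/ve.
    rewrite sumr_const card_ord -[X in X < _]mulr_natr -mulrA gtr_pMr// mulrC ltr_pdivrMr// mul1r.
    by rewrite ltr_nat.
exists p; case: gp => sp mp p0 np; split=> // U; split=> [/np[m [e [e0 eU]]]|].
  by exists m.+1, e; split=> // v ve; apply: eU; exact: ve.
move=> [[|m] [e [e0 eU]]]; apply/np.
  by exists 0%N, 1; split=> // v _; exact: eU.
exists m, e; split=> // v /= ve; apply: eU => i; rewrite ltnS => im.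
exact: le_lt_trans (mp _ _ _ im) ve.
Qed.

Lemma closure_gradedP P S v : graded P -> closure (S : set V) v <->
  forall m (e : R), 0 < e -> exists2 w, S w & P m (v - w) < e.
Proof.
move=> gP; split=> [cS m e e0|H U].
  have [w [Sw /= we]] := cS _ (continuous_seminorm_nbhs v (graded_continuous m gP) e0).
  by exists w => //; rewrite seminormBC//; case: gP.
case: gP => sP _ _ nP; move=> /nbhs_addr/nP[m [e [e0 eU]]].
have [w Sw we] := H m e e0; exists w; split=> //.
by have := eU (w - v); rewrite /= [v + _]addrC subrK; apply; rewrite seminormBC.
Qed.

(** The quotient seminorm of [p] modulo [S], pulled back to V. *)
Definition pdist p S (v : V) : R := inf [set p (v + w) | w in S].

Section PDist.
Variables (p : V -> R) (S : submod V).
Hypothesis sp : seminorm p.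

Let has_inf_pdist v : has_inf [set p (v + w) | w in S].
Proof.
split; first by exists (p (v + 0)), 0 => //; exact: submod0.
by exists 0 => _ [w _ <-]; exact: seminorm_ge0.
Qed.

Lemma pdist_le v w : S w -> pdist p S v <= p (v + w).
Proof. by move=> Sw; apply: ge_inf; [case: (has_inf_pdist v)|exists w]. Qed.

Lemma pdist_le0 v : pdist p S v <= p v.
Proof. by have := pdist_le v (submod0 S); rewrite addr0. Qed.

Lemma le_pdist v c : (forall w, S w -> c <= p (v + w)) -> c <= pdist p S v.
Proof.
by move=> H; apply: lb_le_inf => [|_ [w Sw <-]]; [case: (has_inf_pdist v)|exact: H].
Qed.

Lemma pdist_lt v e : pdist p S v < e -> exists2 w, S w & p (v + w) < e.
Proof.
move=> ve; have e0 : 0 < e - pdist p S v by rewrite subr_gt0.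
have [_ [w Sw <-]] := inf_adherent e0 (has_inf_pdist v).
by rewrite -/(pdist p S v) addrCA subrr addr0 => pe; exists w.
Qed.

Lemma pdist_ge0 v : 0 <= pdist p S v.
Proof. by apply: le_pdist => w _; exact: seminorm_ge0. Qed.

Lemma pdist_seminorm : seminorm (pdist p S).
Proof.
have add u v : pdist p S (u + v) <= pdist p S u + pdist p S v.
  rewrite -lerBlDr; apply: le_pdist => w Sw; rewrite lerBlDr -lerBlDl.
  apply: le_pdist => w' Sw'; rewrite lerBlDl.
  apply: le_trans (pdist_le _ (submodD Sw Sw')) _.
  by rewrite addrACA; exact: sp.1.
split=> // a v; have [->|a0] := eqVneq a 0.
  rewrite scale0r normr0 mul0r; apply/eqP; rewrite eq_le pdist_ge0 andbT.
  by rewrite -(seminorm0 sp) pdist_le0.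
have na : 0 < complex.Re `|a|.
  have : 0 < `|a| by rewrite normr_gt0.
  by rewrite ltcE => /andP[_].
apply/eqP; rewrite eq_le; apply/andP; split.
  rewrite -ler_pdivrMl//; apply: le_pdist => w Sw; rewrite ler_pdivrMl//.
  by rewrite -sp.2 scalerDr; apply: pdist_le; exact: submodZ.
apply: le_pdist => w Sw; rewrite -ler_pdivlMl//.
have -> : a *: v + w = a *: (v + a^-1 *: w) by rewrite scalerDr scalerA mulfV// scale1r.
by rewrite sp.2 mulKf ?gt_eqF//; apply: pdist_le; exact: submodZ.
Qed.

Lemma pdist_sub v : S v -> pdist p S v = 0.
Proof.
move=> Sv; apply/eqP; rewrite eq_le pdist_ge0 andbT -(seminorm0 sp) -(subrr v).
by apply: pdist_le; exact: submodN.
Qed.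

Lemma pdist_eq u v : S (u - v) -> pdist p S u = pdist p S v.
Proof.
have le x y : S (x - y) -> pdist p S x <= pdist p S y.
  move=> Sxy; have := pdist_seminorm.1 (x - y) y; rewrite subrK.
  by rewrite (pdist_sub Sxy) add0r.
move=> Suv; apply/eqP; rewrite eq_le !le// -opprB; exact: submodN.
Qed.

End PDist.

Lemma closure_pdistP P S v : graded P ->
  closure (S : set V) v <-> forall m, pdist (P m) S v = 0.
Proof.
move=> gP; have sP m : seminorm (P m) by case: gP.
split=> [/(closure_gradedP _ _ gP) H m|H].
  apply/eqP; rewrite eq_le pdist_ge0// andbT; apply/ler_addgt0Pr => e e0.
  have [w Sw we] := H m e e0; rewrite add0r; apply/ltW; apply: le_lt_trans we.
  by apply: pdist_le => //; exact: submodN.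
apply/(closure_gradedP _ _ gP) => m e e0.
have [w Sw we] : exists2 w, S w & P m (v + w) < e by apply: pdist_lt => //; rewrite H.
by exists (- w); [exact: submodN|rewrite opprK].
Qed.

Lemma deriv0_seminorm p (c : R -> V) w (e : R) : continuous_seminorm p -> 0 < e ->
  Defs.deriv0 c w -> \forall h \near 0^', p ((h^-1)%:C *: (c h - c 0) - w) < e.
Proof. by move=> cp e0 dw; exact: dw (continuous_seminorm_nbhs w cp e0). Qed.

(* Mean value theorem: the distance of phi(t) to F is a real function with
   zero derivative. *)
Lemma deriv0_in_closed P (F : submod V) (phi : R -> V) (t : R) : graded P ->
  closed (F : set V) -> F (phi 0) ->
  (forall t, exists2 w, F w & Defs.deriv0 (fun h => phi (t + h)) w) -> F (phi t).
Proof.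
move=> gP cF F0 dphi; suff : closure (F : set V) (phi t) by move/cF.
apply/(closure_pdistP _ _ gP) => m; have sp : seminorm (P m) by case: gP.
have sd := pdist_seminorm F sp.
rewrite -(pdist_sub sp F0).
apply: (@is_derive_0_is_cst _ (fun t => pdist (P m) F (phi t))) => x.
suff H : (fun h : R => h^-1 *: (pdist (P m) F (phi (h *: 1 + x)) - pdist (P m) F (phi x)))
    @ 0^' --> (0 : R).
  by split; [exact: cvgP H|exact: (cvg_lim _ H)].
apply/cvgrPdist_lt => e e0; have [w Fw dw] := dphi x.
have := deriv0_seminorm (graded_continuous m gP) e0 dw.
have h0 : \forall h \near 0^', h != 0 :> R by exact: nbhs_dnbhs_neq.
apply: filterS2 h0 => h h0 /=; rewrite addr0 => he.
rewrite sub0r normrN normrM normfV -ltr_pdivlMl ?invr_gt0 ?normr_gt0// invrK.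
(* The increment of the distance is at most the distance of the increment, and the difference
   quotient y of phi has distance at most P m (y - w) because w lies in F. *)
apply: le_lt_trans (seminorm_dist _ _ sd) _.
rewrite [h *: 1]mulr1 [h + x]addrC -ltr_pdivrMl ?normr_gt0// -normfV -seminormZ//.
set y := _%:C *: _ in he *.
have := sd.1 (y - w) w; rewrite subrK (pdist_sub _ Fw)// addr0 => /le_lt_trans; apply.
exact: le_lt_trans (pdist_le0 _ sp _) he.
Qed.

End Seminorms.

(** * Quotients of Frechet spaces and the Mittag-Leffler lemma *)

Section Sequences.
Variables (R : realType) (V : topologicalLmodType R[i]).
Variable P : nat -> V -> R.
Hypothesis gP : graded P.

Let sP m : seminorm (P m). Proof. by case: gP. Qed.

Lemma cvg_gradedP (u : nat -> V) (l : V) : u @ \oo --> l <->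
  forall m (e : R), 0 < e -> exists M, forall j, (M <= j)%N -> P m (u j - l) < e.
Proof.
split=> [ul m e e0|H U].
  by have [M _ MP] := ul _ (continuous_seminorm_nbhs l (graded_continuous m gP) e0); exists M.
case: (gP) => _ _ _ nP; move=> /nbhs_addr/nP[m [e [e0 eU]]].
have [M MP] := H m e e0; exists M => // j /= /MP /eU /=.
by rewrite addrC subrK.
Qed.

(** The subtracted tail of the geometric series is kept so that the induction on d closes. *)
Lemma telescope_seminorm (q : V -> R) (u : nat -> V) (c : R) i d : seminorm q ->
  (forall k, (i <= k)%N -> q (u k.+1 - u k) <= c / 2 ^+ k) ->
  q (u (i + d)%N - u i) <= 2 * c / 2 ^+ i - 2 * c / 2 ^+ (i + d).
Proof.
move=> sq H; elim: d => [|d IH]; first by rewrite addn0 !subrr seminorm0.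
have -> : u (i + d.+1)%N - u i = (u (i + d).+1 - u (i + d)%N) + (u (i + d)%N - u i).
  by rewrite addnS addrA subrK.
apply: le_trans (sq.1 _ _) _; apply: le_trans (lerD (H _ (leq_addr _ _)) IH) _.
rewrite addnS exprS.
have -> : 2 * c / (2 * 2 ^+ (i + d)) = c / 2 ^+ (i + d) by field; rewrite expf_neq0.
lra.
Qed.

Lemma telescope_cvg (u : nat -> V) (c : R) : seq_complete V -> 0 <= c ->
  (forall k, P k (u k.+1 - u k) <= c / 2 ^+ k) -> exists l : V, u @ \oo --> l.
Proof.
move=> cV c0 H; apply: cV => U nU.
have [_ mP _ nP] := gP; have [m [e [e0 eU]]] := (nP U).1 nU.
(* Both u i and u j are compared with u M, at a cost of 2c / 2^M each; the second argument of [maxn]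
   makes 4c / 2^M < e, the first makes P m accessible from P k. *)
set M := maxn m (Num.bound (4 * c / e)); exists M => i j Mi Mj; apply: eU => /=.
have near k : (M <= k)%N -> P m (u k - u M) <= 2 * c / 2 ^+ M.
  move=> Mk; rewrite -(subnKC Mk).
  apply: le_trans (telescope_seminorm (c := c) _ (sP m) _) _ => [k' Mk'|].
    by apply: le_trans (mP _ _ _ _) (H k'); exact: leq_trans (leq_maxl _ _) Mk'.
  by rewrite gerBl divr_ge0 ?mulr_ge0 ?exprn_ge0.
have -> : u i - u j = (u i - u M) - (u j - u M) by rewrite opprB addrA subrK.
apply: le_lt_trans (seminormB _ _ (sP m)) _.
apply: le_lt_trans (lerD (near _ Mi) (near _ Mj)) _.
rewrite -mulrDl ltr_pdivrMr ?exprn_gt0//.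
have : 4 * c / e < 2 ^+ M.
  apply: lt_le_trans (archi_boundP _) _; first by rewrite divr_ge0 ?mulr_ge0 ?(ltW e0).
  rewrite -natrX ler_nat; apply: leq_trans (leq_maxr m _) _.
  exact: ltnW (ltn_expl _ _).
rewrite ltr_pdivrMr// [_ * e]mulrC; lra.
Qed.

Lemma closed_cvg_in (F : submod V) (u : nat -> V) (l a : V) i : closed (F : set V) ->
  u @ \oo --> l -> (forall j, (i <= j)%N -> F (u j - a)) -> F (l - a).
Proof.
move=> cF /cvg_gradedP ul Fu; suff : closure (F : set V) (l - a) by move/cF.
apply/(closure_gradedP _ _ gP) => m e e0; have [M MP] := ul m e e0.
exists (u (maxn M i) - a); first by apply: Fu; exact: leq_maxr.
by rewrite opprB addrA subrK seminormBC//; apply: MP; exact: leq_maxl.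
Qed.

Lemma cvg_seminorm_le (u : nat -> V) (l a : V) m (c : R) : u @ \oo --> l ->
  (forall j, P m (u j - a) <= c) -> P m (l - a) <= c.
Proof.
move=> /cvg_gradedP ul H; apply/ler_addgt0Pr => e e0; have [M MP] := ul m e e0.
have -> : l - a = (u M - a) - (u M - l) by rewrite opprB [RHS]addrC addrA subrK.
apply: le_trans (seminormB _ _ (sP m)) _; apply: lerD (H M) _.
exact/ltW/MP.
Qed.

End Sequences.

Section QuotientFrechet.
Variables (R : realType) (V : topologicalLmodType R[i]) (S : submod V).
Hypothesis cS : closed (S : set V).

Lemma pdist_qproj (p : V -> R) v : seminorm p ->
  pdist p S (qrepr (qproj S v)) = pdist p S v.
Proof. by move=> sp; apply: pdist_eq => //; exact: qrepr_proj. Qed.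

Lemma quot_seminorm (p : V -> R) : seminorm p ->
  seminorm (fun x : qspace S => pdist p S (qrepr x)).
Proof.
move=> sp; have sd := pdist_seminorm S sp; split=> [x y|a x].
  rewrite -[x]qreprK -[y]qreprK -qprojD !pdist_qproj//; exact: sd.1.
by rewrite -[x]qreprK -[a *: _]qprojZ !pdist_qproj//; exact: sd.2.
Qed.

Lemma qproj0 : qproj S 0 = 0.
Proof. by apply: (addrI (qproj S 0)); rewrite -qprojD !addr0. Qed.

Lemma qprojN v : qproj S (- v) = - qproj S v.
Proof. by apply: (addrI (qproj S v)); rewrite -qprojD !subrr qproj0. Qed.

Lemma nbhs0_qproj (U : set (qspace S)) : nbhs 0 U <-> nbhs 0 (qproj S @^-1` U).
Proof.
split=> [nU|/(@nbhs_qproj _ _ S)]; last first.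
  by rewrite qproj0; apply: filterS => _ [v Uv <-].
by apply: (@qproj_continuous _ _ S 0); rewrite qproj0.
Qed.

Lemma quot_continuous_seminorm (p : V -> R) : continuous_seminorm p ->
  continuous_seminorm (fun x : qspace S => pdist p S (qrepr x)).
Proof.
move=> cp; case: (cp) => sp _; split; first exact: quot_seminorm.
apply: seminorm_continuous; first exact: quot_seminorm.
move=> e e0; apply/nbhs0_qproj; have := continuous_seminorm_nbhs 0 cp e0.
apply: filterS => v /=; rewrite subr0 pdist_qproj// => /le_lt_trans; apply.
exact: pdist_le0.
Qed.

Lemma quot_graded (P : nat -> V -> R) : graded P ->
  graded (fun m (x : qspace S) => pdist (P m) S (qrepr x)).
Proof.
move=> gP; have sP m : seminorm (P m) by case: gP.
case: (gP) => _ mP _ nP; split.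
- by move=> m; exact: quot_seminorm.
- move=> j k x jk; apply: le_pdist => // w Sw.
  by apply: le_trans (mP _ _ _ jk); exact: pdist_le.
- move=> x x0; rewrite -[x]qreprK -qproj0; apply/qproj_eq; rewrite subr0.
  have : closure (S : set V) (qrepr x) by apply/(closure_pdistP _ _ gP).
  by move/cS.
- move=> U; split=> [/nbhs0_qproj/nP[m [e [e0 eU]]]|[m [e [e0 eU]]]].
    exists m, e; split=> // x /= /(pdist_lt (sP m))[w Sw we].
    rewrite -[x]qreprK; have <- : qproj S (qrepr x + w) = qproj S (qrepr x).
      by apply/qproj_eq; rewrite addrAC subrr add0r.
    exact: (eU (qrepr x + w)).
  apply/nbhs0_qproj/nP; exists m, e; split=> // v /= ve; apply: eU => /=.
  by rewrite pdist_qproj//; apply: le_lt_trans ve; exact: pdist_le0.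
Qed.

(** A rapidly Cauchy subsequence is lifted term by term, each new lift being corrected by an element
    of S so that it stays 2^-k-close to the previous one. The lifts converge by completeness of V,
    and the Cauchy property extends convergence to the whole sequence. *)
Lemma quot_complete (P : nat -> V -> R) : graded P -> seq_complete V -> seq_complete (qspace S).
Proof.
move=> gP cV u cu; have sP m : seminorm (P m) by case: gP.
have gQ := quot_graded gP; set Q := (fun m x => _) in gQ.
have /choice[N NP] : forall k, exists M, forall i j, (M <= i)%N -> (M <= j)%N ->
    Q k (u i - u j) < 1 / 2 ^+ k.
  move=> k; apply: (cu [set x | Q k x < 1 / 2 ^+ k]).
  have := continuous_seminorm_nbhs 0 (graded_continuous k gQ).
  move=> /(_ (1 / 2 ^+ k)); rewrite divr_gt0 ?exprn_gt0// => /(_ isT).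
  by under [X in nbhs _ X]eq_fun do rewrite subr0.
(* Summing makes the indices nondecreasing, with M k at least N k and at least k. *)
pose M k := (\sum_(i < k.+1) N i + k)%N.
have MS k : (M k <= M k.+1)%N.
  by rewrite /M [in leqRHS]big_ord_recr /= -addnA leq_add2l addnS -addSn leq_addl.
have NM k : (N k <= M k)%N by rewrite /M big_ord_recr /= -addnA addnCA leq_addr.
(* One-step lifting as a total function, ready for recursion; 0 is a placeholder where the given
   vector is not a lift. *)
have /choice[f fP] : forall z : nat * V, exists w : V,
    u (M z.1) = qproj S z.2 ->
      u (M z.1.+1) = qproj S w /\ P z.1 (w - z.2) < 1 / 2 ^+ z.1.
  move=> [k v]; have [ukv|] := pselect (u (M k) = qproj S v); last by exists 0.
  have : Q k (u (M k.+1) - u (M k)) < 1 / 2 ^+ k.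
    by apply: NP; [exact: leq_trans (MS k)|].
  rewrite -[u (M k.+1)]qreprK ukv -qprojN -qprojD /Q pdist_qproj//.
  move=> /(pdist_lt (sP k))[w Sw we]; exists (qrepr (u (M k.+1)) + w) => _.
  split; last by rewrite addrAC.
  by apply/esym/qproj_eq; rewrite addrAC subrr add0r.
pose v := nat_rect (fun=> V) (qrepr (u (M 0%N))) (fun k w => f (k, w)).
have uv k : u (M k) = qproj S (v k).
  elim: k => [|k IH]; first by rewrite /= qreprK.
  by have [] := fP (k, v k) IH.
have dv k : P k (v k.+1 - v k) <= 1 / 2 ^+ k.
  by have [_ /ltW] := fP (k, v k) (uv k).
have [l vl] := telescope_cvg gP cV ler01 dv.
exists (qproj S l); apply/(cvg_gradedP gQ) => m e e0.
have e20 : 0 < e / 2 by rewrite divr_gt0.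
have [k1 k1P] := (cvg_gradedP gP _ _).1 vl m _ e20.
have n2 : nbhs 0 [set x | Q m x < e / 2].
  have := continuous_seminorm_nbhs 0 (graded_continuous m gQ) e20.
  by apply: filterS => x /=; rewrite subr0.
have [k2 k2P] := cu _ n2.
exists k2 => j k2j; pose k := maxn k1 k2.
have -> : u j - qproj S l = (u j - u (M k)) + (u (M k) - qproj S l) by rewrite addrA subrK.
case: (gQ) => sQ _ _ _; apply: le_lt_trans ((sQ m).1 _ _) _.
rewrite [e]splitr; apply: ltrD.
  apply: k2P => //; apply: leq_trans (leq_maxr k1 _) _; exact: leq_addl.
rewrite uv -qprojN -qprojD /Q pdist_qproj//.
by apply: le_lt_trans (pdist_le0 _ (sP m) _) _; apply: k1P; exact: leq_maxl.
Qed.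

Lemma quot_frechet : frechet V -> frechet (qspace S).
Proof.
move=> /frechet_graded[[P gP] cV]; apply/frechet_graded; split.
  by eexists; exact: quot_graded gP.
exact: quot_complete gP cV.
Qed.

End QuotientFrechet.

(** * Lifting coherent families *)

Section MittagLeffler.
Variables (R : realType) (V : topologicalLmodType R[i]) (F : filtration V).
Variable P : nat -> V -> R.
Hypothesis gP : graded P.
Hypothesis cV : seq_complete V.
Hypothesis cF : forall k, closed (F k : set V).
Hypothesis denseF : forall m, exists k0, forall k, (k0 <= k)%N ->
  forall v (e : R), F k v -> 0 < e -> exists2 w, F k.+1 w & P m (v - w) < e.

Let sP m : seminorm (P m). Proof. by case: gP. Qed.

(** K is chosen before x, u and e. Because of this uniformity, a single coordinate of the limit
    controls P m of a suitable lift, which is what continuity of the inverse map requires. *)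
Lemma mittag_leffler : exists K : nat -> nat,
  forall (x : invlim F) m u (e : R), 0 < e -> x (K m) = qproj _ u ->
    exists2 v, lim_nat F v = x & P m (v - u) <= e.
Proof.
have /choice[k0 k0P] := denseF.
pose K m := (\sum_(i < m.+1) k0 i + m)%N.
have KS k : (K k <= K k.+1)%N.
  by rewrite /K [in leqRHS]big_ord_recr /= -addnA leq_add2l addnS -addSn leq_addl.
have k0K k : (k0 k <= K k)%N by rewrite /K big_ord_recr /= -addnA addnCA leq_addr.
have Kge k : (k <= K k)%N by exact: leq_addl.
have Kmono i j : (i <= j)%N -> (K i <= K j)%N.
  by move=> ij; apply: (homo_leq (r := leq)) ij => //; exact: leq_trans.
(* K may jump over several stages, so the one-stage density is composed d times for the same
   seminorm, half of the tolerance being spent at each stage. *)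
have dense m d v (e : R) : F (K m) v -> 0 < e ->
    exists2 w, F (K m + d)%N w & P m (v - w) < e.
  elim: d e => [|d IH] e Fv e0.
    by exists v; rewrite ?addn0// subrr seminorm0.
  have e20 : 0 < e / 2 by rewrite divr_gt0.
  have [w Fw we] := IH _ Fv e20.
  have [w' Fw' we'] := k0P m (K m + d)%N (leq_trans (k0K m) (leq_addr _ _)) _ _ Fw e20.
  exists w'; first by rewrite addnS.
  have -> : v - w' = (v - w) + (w - w') by rewrite addrA subrK.
  by rewrite [e]splitr; apply: le_lt_trans ((sP m).1 _ _) (ltrD we we').
exists K => x m u e e0 xu.
have /choice[f fP] : forall z : nat * V, exists w : V,
    x (K (m + z.1)%N) = qproj _ z.2 ->
      x (K (m + z.1.+1)%N) = qproj _ w /\ P (m + z.1)%N (w - z.2) < e / 2 / 2 ^+ z.1.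
  move=> [j v] /=; have [xv|] := pselect (x (K (m + j)%N) = qproj _ v); last by exists 0.
  (* Any representative v' at the deeper level differs from v by an element of F (K (m + j)).
     Approximating that difference by w in F (K (m + j + 1)) and passing to v' - w keeps the class
     and brings it close to v. *)
  set v' := qrepr (x (K (m + j.+1)%N)).
  have Kj : (K (m + j) <= K (m + j.+1))%N by apply: Kmono; rewrite leq_add2l.
  have Fv : F (K (m + j)%N) (v' - v).
    by apply/qproj_eq; rewrite -xv; exact: lim_coherent.
  have b0 : 0 < e / 2 / 2 ^+ j by rewrite !divr_gt0 ?exprn_gt0.
  have [w Fw we] := dense _ (K (m + j.+1) - K (m + j))%N _ _ Fv b0.
  rewrite subnKC// in Fw; exists (v' - w) => _; split; last by rewrite addrAC.
  by rewrite -[LHS]qreprK -/v'; apply/qproj_eq; rewrite opprB addrC subrK.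
pose v := nat_rect (fun=> V) u (fun k w => f (k, w)).
have xv k : x (K (m + k)%N) = qproj _ (v k).
  elim: k => [|k IH]; first by rewrite addn0.
  by have [] := fP (k, v k) IH.
have dv k : P (m + k)%N (v k.+1 - v k) <= e / 2 / 2 ^+ k.
  by have [_ /ltW] := fP (k, v k) (xv k).
have mP : forall j k v, (j <= k)%N -> P j v <= P k v by case: gP.
have [l vl] : exists l : V, v @ \oo --> l.
  apply: (telescope_cvg gP (c := e / 2)) => //; first by rewrite divr_ge0 ?(ltW e0).
  by move=> k; apply: le_trans (dv k); apply: mP; exact: leq_addl.
exists l; last first.
  apply: (cvg_seminorm_le gP vl) => j.
  have := @telescope_seminorm _ _ (P m) v (e / 2) 0 j (sP m).
  rewrite add0n expr0 divr1 => /(_ _)/le_trans; apply.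
    by move=> k _; apply: le_trans (dv k); apply: mP; exact: leq_addr.
  have : 0 <= 2 * (e / 2) / 2 ^+ j by rewrite divr_ge0 ?mulr_ge0 ?divr_ge0 ?exprn_ge0 ?(ltW e0).
  lra.
apply: invlim_ext => k /=.
apply/esym/(coherent_lift (k := K (m + k)%N)).
  by apply: leq_trans (Kge _); exact: leq_addl.
rewrite xv; apply/esym/qproj_eq.
(* From index k on, all the v_j have the class of v_k at level K (m + k); closedness hands this on
   to the limit. *)
apply: (@closed_cvg_in _ _ _ gP (F (K (m + k)%N)) v l (v k) k (@cF _) vl) => j kj.
apply/qproj_eq; rewrite -xv; apply/esym/(coherent_lift _ (xv j)).
by apply: Kmono; rewrite leq_add2l.
Qed.

End MittagLeffler.

(** * The action of the nilradical *)

Lemma sub_regroup (V : zmodType) (a b c d v : V) :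
  - a + b - (- c + d) = (b - v - a) - (d - v - c).
Proof.
rewrite [b - v - a]addrAC [d - v - c]addrAC [X in _ = _ + X]opprB.
by rewrite [RHS]addrA subrK [- a + b]addrC [- c + d]addrC.
Qed.

Section Deriv.
Variables (R : realType) (V : topologicalLmodType R[i]).

Lemma deriv0_unique (P : nat -> V -> R) (c : R -> V) w w' : graded P ->
  Defs.deriv0 c w -> Defs.deriv0 c w' -> w = w'.
Proof.
move=> gP dw dw'; have sP m : seminorm (P m) by case: gP.
apply/eqP; rewrite -subr_eq0; apply/eqP; case: (gP) => _ _ + _; apply => m.
apply/eqP; rewrite eq_le seminorm_ge0// andbT; apply/ler_addgt0Pr => e e0; rewrite add0r.
have e20 : 0 < e / 2 by rewrite divr_gt0.
have H1 := deriv0_seminorm (graded_continuous m gP) e20 dw.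
have H2 := deriv0_seminorm (graded_continuous m gP) e20 dw'.
have [h [/ltW h1 /ltW h2]] := filter_ex (filterI H1 H2).
set y := _ *: _ in h1 h2.
have -> : w - w' = (y - w') - (y - w) by rewrite opprB [RHS]addrC addrA subrK.
by rewrite [e]splitr; apply: le_trans (seminormB _ _ (sP m)) (lerD h2 h1).
Qed.

Lemma deriv0_comp (W : topologicalLmodType R[i]) (f : V -> W) (c : R -> V) w :
  linear f -> continuous f -> Defs.deriv0 c w -> Defs.deriv0 (f \o c) (f w).
Proof.
move=> lf cf dw.
have fB u v : f (u - v) = f u - f v.
  by have := lf (-1) v u; rewrite !scaleN1r [- v + u]addrC [- f v + f u]addrC.
have f0 : f 0 = 0 by rewrite -(subrr 0) fB subrr.
have fZ a u : f (a *: u) = a *: f u by have := lf a u 0; rewrite f0 !addr0.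
have : f ((h^-1)%:C *: (c h - c 0)) @[h --> 0^'] --> f w.
  exact: (cvg_comp _ _ dw (cf w)).
by under [X in X @ _]eq_fun do rewrite fZ fB.
Qed.

Lemma scalev_continuous (a : R[i]) : continuous (fun v : V => a *: v).
Proof.
move=> v U nU.
have [[A B]/= [nA nB] AB] := @scale_continuous _ V (a, v) U nU.
suff : B `<=` [set w | U (a *: w)] by move=> BU; exact: filterS BU nB.
by move=> w Bw; exact: (AB (a : R[i]^o, w) (conj (nbhs_singleton nA) Bw)).
Qed.

Lemma deriv0_linear (a : R[i]) (c c' : R -> V) w w' :
  Defs.deriv0 c w -> Defs.deriv0 c' w' ->
  Defs.deriv0 (fun h => a *: c h + c' h) (a *: w + w').
Proof.
move=> dw dw'; rewrite /Defs.deriv0.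
under [X in X @ _]eq_fun => h.
  rewrite opprD addrACA -scalerBr scalerDr scalerA mulrC -scalerA.
  over.
move=> U /(@add_continuous V (a *: w, w')) [[A B]/= [nA nB] AB].
have H1 := dw _ (@scalev_continuous a w _ nA); have H2 := dw' _ nB.
have H : \forall h \near (0 : R)^', A (a *: ((h^-1)%:C *: (c h - c 0))) /\
    B ((h^-1)%:C *: (c' h - c' 0)) by exact: (@filterI _ (dnbhs (0 : R)) _ _ _ H1 H2).
exact: (@filterS _ (dnbhs (0 : R)) _ _ _ (fun h ABh => AB (_, _) ABh) H).
Qed.

End Deriv.

Section LieAction.
Variables (R : realType) (G : topGroupType) (n : nat) (rho : G -> 'M[R]_n.+1).
Variables (s : G -> R) (P N : set G).
Hypothesis rr : real_reductive rho.
Hypothesis uN : unipotent_normal rho P N.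

Let gexp_scaleE X gamma (t : R) : one_param rho X gamma -> gexp rho (t *: X) = gamma t.
Proof. by case: rr => hG _ [r1 rM] kf _; exact: gexp_scale. Qed.

Lemma unipotent_normal_sub : N `<=` P.
Proof. by case: uN. Qed.

Lemma LieAlg_sub (A B : set G) : A `<=` B -> LieAlg rho A `<=` LieAlg rho B.
Proof. by move=> AB X [gamma oX gA]; exists gamma => // t; exact/AB/gA. Qed.

Lemma LieAlg0 (A : set G) : A 1%g -> LieAlg rho A 0.
Proof. by move=> A1; exists (fun=> 1%g) => //; exact: one_param_cst. Qed.

Lemma LieAlg_conj g X : P g -> LieAlg rho N X -> LieAlg rho N (rho g * X * (rho g)^-1).
Proof.
move=> Pg [gamma oX gN]; case: (rr) => _ _ [r1 rM] _ _.
exists (fun t => g * gamma t * g^-1)%g; first exact: one_param_conj.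
by case: uN => _ _ nN _ _ t; apply: nN.
Qed.

Section OneRep.
Variable V : rep_space R G.
Hypothesis RV : in_RepF rho s P V.

Let gradedV : exists PP : nat -> V -> R, graded PP.
Proof. by case: RV => /frechet_graded[]. Qed.

Lemma rep_act1 (v : V) : rep_act 1%g v = v.
Proof. by case: RV => _ [[H _]]. Qed.

Lemma rep_actM g h (v : V) : P g -> P h -> rep_act (g * h)%g v = rep_act g (rep_act h v).
Proof. by case: RV => _ [[_ H] _ _ _ _]; exact: H. Qed.

Lemma rep_act_linear g : P g -> linear (@rep_act _ _ V g).
Proof. by case: RV => _ [_ H _ _ _]; exact: H. Qed.

Lemma rep_actB g (u v : V) : P g -> rep_act g (u - v) = rep_act g u - rep_act g v.
Proof.
move=> Pg; have := rep_act_linear Pg (-1) v u.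
by rewrite !scaleN1r [- v + u]addrC [- rep_act g v + _]addrC.
Qed.

Lemma rep_act_continuous g : P g -> continuous (@rep_act _ _ V g).
Proof.
move=> Pg v; case: RV => _ [_ _ /subspace_continuousP cV _ _].
have := cV (g, v) (conj Pg I); rewrite /= => cgv U /cgv[[A B] /= [nA nB] AB].
apply: filterS nB => w Bw; apply: (AB (g, w)); last by [].
by split=> //=; exact: nbhs_singleton.
Qed.

(** Smoothness of the orbit map in the chart at the identity, differentiated at 0 in the direction
    X. *)
Lemma lie_act_exists X (v : V) : LieAlg rho P X -> exists w, lie_act rho X v w.
Proof.
move=> PX; have P1 : P 1%g by case: uN => -[N1 _ _] NP _ _ _; exact: NP.
case: RV => _ [_ _ _ + _] => /(_ v 1%g P1)[U [_ U0] /(_ 1%N)/= [_ /(_ X PX)[f' f'P _]]].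
exists (f' 0); have := f' 0; have := f'P 0 (conj U0 (LieAlg0 P1)).
by rewrite /lie_act; under [X in Defs.deriv0 X _ -> _]eq_fun do rewrite mul1g add0r.
Qed.

Lemma lie_act_unique X (v w w' : V) : lie_act rho X v w -> lie_act rho X v w' -> w = w'.
Proof. by have [PP gP] := gradedV; exact: deriv0_unique gP. Qed.

Lemma lie_act_linear X (a : R[i]) (u v w z : V) : LieAlg rho N X ->
  lie_act rho X u w -> lie_act rho X v z -> lie_act rho X (a *: u + v) (a *: w + z).
Proof.
move=> [gamma oX gN] uw vz; have := @deriv0_linear _ _ a _ _ _ _ uw vz; rewrite /lie_act.
under [X in Defs.deriv0 X _ -> _]eq_fun => t.
  rewrite -rep_act_linear; first over.
  by rewrite (gexp_scaleE t oX); exact/unipotent_normal_sub/gN.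
by [].
Qed.

Lemma lie_act_flow X gamma (v w : V) (t : R) : one_param rho X gamma ->
  (forall t, N (gamma t)) -> lie_act rho X v w ->
  Defs.deriv0 (fun h => rep_act (gamma (t + h)) v) (rep_act (gamma t) w).
Proof.
move=> oX gN vw; have NP x := unipotent_normal_sub (gN x).
have := deriv0_comp (rep_act_linear (NP t)) (rep_act_continuous (NP t)) vw.
congr Defs.deriv0; apply/funext => h /=.
by rewrite (gexp_scaleE h oX) -rep_actM//; case: oX => _ ->.
Qed.

Local Notation nk := (npow rho N V).
Local Notation Fk := (npow_filtration rho N V).

Lemma npow_sub_closure k : nk k `<=` Fk k.
Proof. exact: subset_closure. Qed.

Lemma closed_npow k : closed (Fk k : set V).
Proof. exact: closed_closure. Qed.

Lemma lie_act_npow k X (v w : V) : LieAlg rho N X -> nk k v -> lie_act rho X v w ->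
  nk k.+1 w.
Proof.
move=> NX; suff H : nk k `<=` [set v | exists2 w, nk k.+1 w & lie_act rho X v w].
  by move=> /H[w' nw' vw'] vw; rewrite (lie_act_unique vw vw').
have sub : subspace_set [set v : V | exists2 w, nk k.+1 w & lie_act rho X v w].
  split=> [|a u u' [x nx ux] [x' nx' ux']].
    exists 0; first exact: (submod0 (nk k.+1)).
    have [x0 ux] := lie_act_exists 0 (LieAlg_sub unipotent_normal_sub NX).
    by have := @lie_act_linear _ (-1) _ _ _ _ NX ux ux; rewrite !scaleN1r !addNr.
  exists (a *: x + x'); first exact: (submodZD (S := nk k.+1)).
  exact: lie_act_linear.
apply: (@span_set_min _ _ _ (Submod sub)) => u mu /=.
have [x ux] := lie_act_exists u (LieAlg_sub unipotent_normal_sub NX).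
by exists x => //; apply: sub_span_set; exists X => //; exists u.
Qed.

(** From g exp(hX) v = exp(h Ad(g)X) g v, where Ad(g)X stays in Lie(N) by normality. *)
Lemma lie_monomials_inv k g (v : V) : P g ->
  @lie_monomials _ _ _ rho N V k v -> @lie_monomials _ _ _ rho N V k (rep_act g v).
Proof.
move=> Pg; elim: k v => //= k IH w [X NX [v mv vw]].
exists (rho g * X * (rho g)^-1); first exact: LieAlg_conj.
exists (rep_act g v); first exact: IH.
have := deriv0_comp (rep_act_linear Pg) (rep_act_continuous Pg) vw.
congr Defs.deriv0; apply/funext => h /=; case: NX => gamma oX gN.
case: (rr) => _ _ [r1 rM] _ _; have oc := one_param_conj r1 rM g oX.
have PN := unipotent_normal_sub; case: (uN) => _ _ nN _ _.
have Pc : P (g * gamma h * g^-1)%g by apply: PN; exact: nN.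
rewrite (gexp_scaleE h oX) (gexp_scaleE h oc) -(rep_actM _ Pg (PN _ (gN h))).
by rewrite -(rep_actM _ Pc Pg) mulgVK.
Qed.

Lemma npow_inv k g (v : V) : P g -> Fk k v -> Fk k (rep_act g v).
Proof.
move=> Pg; have H : nk k `<=` [set v | nk k (rep_act g v)].
  have sub : subspace_set [set v | nk k (rep_act g v)].
    have lg := rep_act_linear Pg.
    split=> [|a u u' nu nu'] /=.
      by rewrite -(subrr 0) rep_actB// subrr; exact: (submod0 (nk k)).
    by rewrite lg; exact: (submodZD (S := nk k)).
  apply: (@span_set_min _ _ _ (Submod sub)) => u mu /=.
  by apply: sub_span_set; exact: lie_monomials_inv.
move=> cv B /(rep_act_continuous Pg)/cv[u [nu Bu]].
by exists (rep_act g u); split=> //; exact: H.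
Qed.

(** For v in n^k the velocity gamma(x) X v of the orbit stays in the closed invariant subspace
    F_(k+1), so the mean value argument applies; continuity extends the result to v in F_k. *)
Lemma flow_diff k X gamma (v : V) (t : R) : one_param rho X gamma ->
  (forall t, N (gamma t)) -> Fk k v -> Fk k.+1 (rep_act (gamma t) v - v).
Proof.
move=> oX gN; have NX : LieAlg rho N X by exists gamma.
have [PP gP] := gradedV; have NP x := unipotent_normal_sub (gN x).
have g0 : gamma 0 = 1%g by case: (rr) => _ _ [r1 rM] _ _; exact: one_param0 oX.
have H : nk k `<=` [set v | Fk k.+1 (rep_act (gamma t) v - v)].
  move=> u nu /=; apply: (@deriv0_in_closed _ _ PP (Fk k.+1)
    (fun t => rep_act (gamma t) u - u) t gP).
  - exact: closed_npow.
  - by rewrite g0 rep_act1 subrr; exact: (submod0 (Fk k.+1)).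
  - move=> x; have [w uw] := lie_act_exists u (LieAlg_sub unipotent_normal_sub NX).
    exists (rep_act (gamma x) w).
      by apply: npow_inv => //; apply: npow_sub_closure; exact: lie_act_npow uw.
    have := lie_act_flow (t := x) oX gN uw; rewrite /Defs.deriv0.
    by under [X in _ -> X @ _ --> _]eq_fun do rewrite opprB addrA subrK.
move=> cv; apply: (@closed_npow k.+1) => B nB.
have cf : {for v, continuous (fun v => rep_act (gamma t) v - v)}.
  apply: (@continuous_comp _ _ _ (fun v => (rep_act (gamma t) v, v))
    (fun z : V * V => z.1 - z.2)); last exact: sub_continuous.
  by apply: cvg_pair; [exact: rep_act_continuous|exact: cvg_id].
have [u [nu Bu]] := cv _ (cf _ nB).
by exists (rep_act (gamma t) u - u); split=> //; exact: H.
Qed.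

(** First-order Taylor formula: the derivative of the remainder is gamma(x) w - w with w = X v in
    n^(k+1), and [flow_diff] puts it in F_(k+2). *)
Lemma flow_diff2 k X gamma (v w : V) (t : R) : one_param rho X gamma ->
  (forall t, N (gamma t)) -> nk k v -> lie_act rho X v w ->
  Fk k.+2 (rep_act (gamma t) v - v - t%:C *: w).
Proof.
move=> oX gN nv vw; have NX : LieAlg rho N X by exists gamma.
have [PP gP] := gradedV.
have g0 : gamma 0 = 1%g by case: (rr) => _ _ [r1 rM] _ _; exact: one_param0 oX.
apply: (@deriv0_in_closed _ _ PP (Fk k.+2)
  (fun t => rep_act (gamma t) v - v - t%:C *: w) t gP).
- exact: closed_npow.
- by rewrite g0 rep_act1 subrr scale0r subrr; exact: (submod0 (Fk k.+2)).
- move=> x; exists (rep_act (gamma x) w - w).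
    by apply: flow_diff oX gN _; apply: npow_sub_closure; exact: lie_act_npow vw.
  have d1 : Defs.deriv0 (fun h : R => (x + h)%:C *: w) w.
    rewrite /Defs.deriv0; apply: cvg_near_cst.
    have := @nbhs_dnbhs_neq R 0; apply: filterS => h h0.
    rewrite addr0 -scalerBl -rmorphB /= addrC addKr scalerA -rmorphM /= mulVf//.
    by rewrite scale1r.
  have := @deriv0_linear _ _ (-1) _ _ _ _ d1 (lie_act_flow (t := x) oX gN vw).
  rewrite scaleN1r addrC /Defs.deriv0.
  under [X in X @ _ --> _ -> _]eq_fun => h.
    rewrite !scaleN1r.
    have -> : - ((x + h)%:C *: w) + rep_act (gamma (x + h)) v -
       (- ((x + 0)%:C *: w) + rep_act (gamma (x + 0)) v) =
       (rep_act (gamma (x + h)) v - v - (x + h)%:C *: w) -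
       (rep_act (gamma (x + 0)) v - v - (x + 0)%:C *: w).
      exact: sub_regroup.
    over.
  exact.
Qed.

End OneRep.
End LieAction.

(** * Density of the filtration *)

Lemma sub_split (V : zmodType) (a b c x y : V) :
  x - a - c = ((x - y) - (a - b)) + ((y - b) - c).
Proof.
rewrite [RHS]addrA; congr (_ - c).
by rewrite opprB [RHS]addrACA subrK addrAC subrr add0r.
Qed.

Section Words.
Variables (R : realType) (G : topGroupType) (n : nat) (rho : G -> 'M[R]_n.+1).
Variables (s : G -> R) (P N : set G).
Hypothesis rr : real_reductive rho.
Hypothesis uN : unipotent_normal rho P N.

(** The inverse is bounded as well because the scale of g involves both rho(g) and rho(g^-1). *)
Definition small (C : R) : set G := [set u | [/\ N u, mxnorm1 (rho u - 1) <= C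
  & mxnorm1 (rho u^-1%g - 1) <= C]].

Fixpoint word (C : R) (l : nat) (g : G) : Prop :=
  if l is l'.+1 then exists u g', [/\ small C u, word C l' g' & g = (u * g')%g]
  else g = 1%g.

Let rho1 : rho 1%g = 1. Proof. by case: rr => _ _ [r1 rM]. Qed.
Let rhoM g h : rho (g * h)%g = rho g * rho h. Proof. by case: rr => _ _ [r1 rM]. Qed.

Lemma smallV C u : small C u -> small C u^-1%g.
Proof. by move=> [Nu uC uVC]; split; rewrite ?invgK//; case: uN => -[_ _ +] _ _ _ _; apply. Qed.

Lemma le_small C C' : C <= C' -> small C `<=` small C'.
Proof. by move=> CC' u [Nu uC uVC]; split=> //; [exact: le_trans CC'|exact: le_trans CC']. Qed.

Lemma small_exists u : N u -> exists2 C, 0 <= C & small C u.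
Proof.
move=> Nu; exists (mxnorm1 (rho u - 1) + mxnorm1 (rho u^-1%g - 1)).
  by rewrite addr_ge0 ?mxnorm1_ge0.
by split; rewrite ?lerDl ?lerDr ?mxnorm1_ge0.
Qed.

Lemma wordM C l l' g g' : word C l g -> word C l' g' -> word C (l + l') (g * g')%g.
Proof.
move=> + wg'; elim: l g => [_ ->|l IH _ [u [h [Cu wh ->]]]]; first by rewrite mul1g.
by exists u, (h * g')%g; split=> //; [exact: IH|rewrite mulgA].
Qed.

Lemma word1 C u : small C u -> word C 1 u.
Proof. by move=> Cu; exists u, 1%g; split=> //; rewrite mulg1. Qed.

Lemma wordV C l g : word C l g -> word C l g^-1%g.
Proof.
elim: l g => [_ ->|l IH _ [u [h [Cu wh ->]]]]; first by rewrite invg1.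
by rewrite invgM -addn1; apply: wordM; [exact: IH|exact/word1/smallV].
Qed.

Lemma word_sub C l g : word C l g -> N g.
Proof.
case: uN => -[N1 NM _] _ _ _ _.
by elim: l g => [_ -> //|l IH _ [u [h [[Nu _ _] wh ->]]]]; apply: NM => //; exact: IH.
Qed.

Lemma word_seq C l g : word C l g -> exists ws, [/\ size ws = l,
  forall u, u \in ws -> (rho @` N) u /\ mxnorm1 (u - 1) <= C
  & rho g = \prod_(u <- ws) u].
Proof.
elim: l g => [_ ->|l IH _ [u [h [[Nu uC _] /IH[ws [sws wsP wsE]] ->]]]].
  by exists [::]; split=> //; rewrite big_nil.
exists (rho u :: ws); split=> /= [|v|]; first by rewrite sws.
  by rewrite inE => /orP[/eqP ->|/wsP//]; split=> //; exists u.
by rewrite big_cons -wsE rhoM.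
Qed.

Lemma word_growth C l g : 0 <= C -> word C l g ->
  mxnorm1 (rho g) <= mxnorm1 (1 : 'M[R]_n.+1) * (1 + C * l%:R) ^+ n.+1.
Proof.
move=> C0 /word_seq[ws [<- wsP ->]].
have K := @kolchin R n (rho @` N) _ _ n.+1 1.
rewrite -[\prod_(u <- ws) u]mul1r; apply: kills_growth wsP _ => //.
case: uN => -[_ NM _] _ _ _ uP; apply: K => [_ _ [g1 N1 <-] [g2 N2 <-]|_ [u Nu <-]].
  by exists (g1 * g2)%g; [exact: NM|rewrite rhoM].
exact: uP.
Qed.

Lemma mxtrace_mul_tr (A : 'M[R]_n.+1) : \tr (A *m A^T) <= mxnorm1 A ^+ 2.
Proof.
rewrite /mxtrace expr2 {1}/mxnorm1 mulr_suml; apply: ler_sum => i _.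
rewrite mxE mulr_suml; apply: ler_sum => j _; rewrite mxE.
apply: le_trans (ler_norm _) _; rewrite normrM ler_wpM2l//.
rewrite /mxnorm1 (bigD1 i)//= (bigD1 j)//= -addrA lerDl addr_ge0//.
  exact: sumr_ge0.
by apply: sumr_ge0 => k _; exact: sumr_ge0.
Qed.

Hypothesis scale_s : algebraic_scale rho s.

(** D and b depend on r but not on C or l, so neither the number of monomial factors nor the length
    of the word affects the degree. *)
Lemma scale_growth (r : R) : 0 <= r -> exists D (b : R), 0 <= b /\
  forall C l g, 0 <= C -> word C l g -> s g `^ r <= b * (1 + C * l%:R) ^+ D.
Proof.
move=> r0; case: scale_s => s0 [c [k sk]].
set B := mxnorm1 (1 : 'M[R]_n.+1); have B0 : 0 <= B by exact: mxnorm1_ge0.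
(* The 1 makes c' y^E at least 1, so that the exponent r may be raised to an integer K. In E = 2
   (n+1) k, the 2 comes from the trace of A A^T, n+1 from Kolchin's theorem and k from the
   comparison of scales. *)
pose c' := 1 + `|c| * (2 * B ^+ 2) ^+ k.
have c'1 : 1 <= c' by rewrite lerDl mulr_ge0// exprn_ge0// mulr_ge0// exprn_ge0.
pose E := (2 * n.+1 * k)%N; pose K := Num.bound r.
exists (E * K)%N, (c' ^+ K); split; first by rewrite exprn_ge0// (le_trans ler01).
move=> C l g C0 wg; set y := 1 + C * l%:R.
have y1 : 1 <= y by rewrite lerDl mulr_ge0.
have y0 : 0 <= y by exact: le_trans y1.
have sc : scale_of rho g <= 2 * (B * y ^+ n.+1) ^+ 2.
  rewrite /scale_of mulr2n mulrDl !mul1r; apply: lerD.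
    apply: le_trans (mxtrace_mul_tr _) _; rewrite lerXn2r ?nnegrE ?mxnorm1_ge0//.
      by rewrite mulr_ge0// exprn_ge0.
    exact: word_growth.
  apply: le_trans (mxtrace_mul_tr _) _; rewrite lerXn2r ?nnegrE ?mxnorm1_ge0//.
    by rewrite mulr_ge0// exprn_ge0.
  by apply: word_growth => //; exact: wordV.
have sc0 : 0 <= scale_of rho g.
  rewrite addr_ge0//; apply: sumr_ge0 => i _; rewrite mxE; apply: sumr_ge0 => j _;
    rewrite mxE; exact: sqr_ge0.
have sg : s g <= c' * y ^+ E.
  apply: le_trans (sk g).1 _; apply: (@le_trans _ _ (`|c| * scale_of rho g ^+ k)).
    by rewrite ler_wpM2r ?exprn_ge0// ler_norm.
  apply: (@le_trans _ _ (`|c| * (2 * (B * y ^+ n.+1) ^+ 2) ^+ k)).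
    rewrite ler_wpM2l// lerXn2r// nnegrE mulr_ge0// exprn_ge0//.
    by rewrite mulr_ge0// exprn_ge0.
  have -> : `|c| * (2 * (B * y ^+ n.+1) ^+ 2) ^+ k = `|c| * (2 * B ^+ 2) ^+ k * y ^+ E.
    rewrite /E -mulrA; congr (_ * _).
    rewrite [(B * _) ^+ 2]exprMn mulrA [LHS]exprMn; congr (_ * _).
    by rewrite -!exprM mulnCA mulnA.
  by rewrite ler_wpM2r ?exprn_ge0// lerDr.
have cy1 : 1 <= c' * y ^+ E by rewrite -[1]mulr1 ler_pM// exprn_ege1.
apply: (@le_trans _ _ ((c' * y ^+ E) `^ r)).
  by apply: ge0_ler_powR => //; rewrite nnegrE ?(ltW (s0 g))// (le_trans ler01).
apply: (@le_trans _ _ ((c' * y ^+ E) `^ K%:R)).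
  by apply: ler_powR => //; apply/ltW/archi_boundP.
by rewrite powR_mulrn ?(le_trans ler01)// exprMn exprM.
Qed.

Section Density.
Variable V : rep_space R G.
Hypothesis RV : in_RepF rho s P V.
Variable p : V -> R.
Hypothesis cp : continuous_seminorm p.

Let sp : seminorm p. Proof. by case: cp. Qed.
Local Notation Fk := (npow_filtration rho N V).

(* For w = X_1 ... X_k v and large C, the vector
   (gamma_1(t) - 1) ... (gamma_k(t) - 1) v is t^k w modulo F_(k+1), and it is a
   signed sum of 2^k vectors g v where g is a word of length at most k t. *)
Lemma monomial_approx k (w : V) : @lie_monomials _ _ _ rho N V k w ->
  exists (v : V) (C0 : R), 0 <= C0 /\ forall C, C0 <= C ->
  forall (f : nat -> R), (forall i j, (i <= j)%N -> f i <= f j) ->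
  (forall l g, word C l g -> p (rep_act g v) <= f l) ->
  forall t : nat, exists2 a : V, Fk k.+1 (a - (t%:R ^+ k)%:C *: w) &
    forall l g, word C l g -> p (rep_act g a) <= 2 ^+ k * f (l + k * t)%N.
Proof.
elim: k w => [w _|k IH w [X [gamma oX gN] [v mv vw]]].
  exists w, 0; split=> // C _ f _ fP t; exists w.
    by rewrite expr0 scale1r subrr; exact: (submod0 (Fk 1)).
  by move=> l g wg; rewrite mul1r mul0n addn0; exact: fP.
have [v0 [C0 [C00 H]]] := IH v mv.
have [C1 C10 gC1] := small_exists (gN 1).
exists v0, (C0 + C1); split; first by rewrite addr_ge0.
move=> C CC f fmono fP t.
have C0C : C0 <= C by apply: le_trans CC; rewrite lerDl.
have C1C : C1 <= C by apply: le_trans CC; rewrite lerDr.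
have [a Fa ga] := H C C0C f fmono fP t.
(* Here t is a natural number: gamma(t) is the t-fold product of gamma(1), whose bound C1 does not
   depend on t. *)
have gt : word C t (gamma t%:R).
  elim: {Fa ga} t => [|t IHt].
    by case: (rr) => _ _ _ _ _; exact: one_param0 oX.
  exists (gamma 1), (gamma t%:R); split=> //; first exact: le_small gC1.
  by rewrite -natr1 addrC; case: oX => _ ->.
have NP := unipotent_normal_sub uN.
have PX : P (gamma t%:R) by exact: NP.
exists (rep_act (gamma t%:R) a - a).
  (* The error a - b lies in F_(k+1) and gains one stage by [flow_diff]; the main term b lies in n^k
     and yields t X b modulo F_(k+2) by [flow_diff2]. *)
  set b := (t%:R ^+ k)%:C *: v.
  have -> : rep_act (gamma t%:R) a - a - (t%:R ^+ k.+1)%:C *: w =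
      (rep_act (gamma t%:R) (a - b) - (a - b)) +
      (rep_act (gamma t%:R) b - b - (t%:R)%:C *: ((t%:R ^+ k)%:C *: w)).
    by rewrite scalerA -rmorphM /= -exprS (rep_actB RV _ _ PX); exact: sub_split.
  apply: (submodD (S := Fk k.+2)); first exact: flow_diff RV _ _ _ _ _ oX gN Fa.
  apply: (@flow_diff2 R G n rho s P N rr uN V RV k X gamma b _ t%:R oX gN).
    by apply: (submodZ (S := npow rho N V k)); exact: sub_span_set.
  have NX : LieAlg rho N X by exists gamma.
  (* The multiple t^k v is written as (t^k - 1) v + v to fit the form a u + v of linearity. *)
  have := @lie_act_linear _ _ _ _ _ _ _ rr uN _ RV _ ((t%:R ^+ k)%:C - 1) _ _ _ _ NX vw vw.
  by rewrite !scalerBl !scale1r !subrK.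
move=> l g wg; have Ng := word_sub wg; have Pg := NP _ Ng.
rewrite (rep_actB RV _ _ Pg) -(rep_actM RV _ Pg PX); apply: le_trans (seminormB _ _ sp) _.
have {1}-> : (l + k.+1 * t = (l + t) + k * t)%N by rewrite mulSn addnA.
rewrite exprS -mulrA mulr2n mulrDl !mul1r; apply: lerD.
  exact: ga (wordM wg gt).
apply: le_trans (ga _ _ wg) _; rewrite ler_wpM2l ?exprn_ge0//.
by apply: fmono; rewrite leq_add2r leq_addr.
Qed.

Lemma npow_dense : exists k0, forall k, (k0 <= k)%N ->
  forall (v : V) (e : R), Fk k v -> 0 < e -> exists2 w, Fk k.+1 w & p (v - w) < e.
Proof.
case: (RV) => _ [_ _ _ _ /(_ p cp)[r [p2 [r0 [sp2 _]] rP]]].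
have [D [b [b0 bP]]] := scale_growth r0.
(* One power more than the degree of growth, so that a factor t survives the division by t^D. *)
exists D.+1 => k Dk.
have cF : closed (Fk k.+1 : set V) by exact: closed_npow.
have sd := pdist_seminorm (Fk k.+1) sp.
have H0 w : @lie_monomials _ _ _ rho N V k w -> pdist p (Fk k.+1) w = 0.
  move=> /monomial_approx[v [C [C0 H]]].
  pose f l := b * (1 + C * l%:R) ^+ D * p2 v.
  have fmono i j : (i <= j)%N -> f i <= f j.
    move=> ij; rewrite ler_wpM2r ?seminorm_ge0// ler_wpM2l// lerXn2r ?nnegrE ?addr_ge0 ?mulr_ge0//.
    by rewrite lerD2l ler_wpM2l// ler_nat.
  have fP l g : word C l g -> p (rep_act g v) <= f l.
    move=> wg; apply: le_trans (rP _ _ (unipotent_normal_sub uN (word_sub wg))) _.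
    by rewrite ler_wpM2r ?seminorm_ge0//; exact: bP.
  have {}H := H C (lexx _) f fmono fP.
  set y := pdist p (Fk k.+1) w; have y0 : 0 <= y by exact: pdist_ge0.
  (* For t >= 1 one has 1 + C k t <= (1 + C k) t, which extracts t^D from f (k t) and leaves A. *)
  pose A := 2 ^+ k * (b * (1 + C * k%:R) ^+ D * p2 v).
  have bound t : (0 < t)%N -> y * t%:R <= A.
    move=> t0; have t1 : 1 <= t%:R :> R by rewrite ler1n.
    have [a Fa /(_ 0%N 1%g erefl)] := H t; rewrite (rep_act1 RV) add0n => pa.
    have : t%:R ^+ k * y <= 2 ^+ k * f (k * t)%N.
      have <- : `|t%:R ^+ k : R| = t%:R ^+ k by rewrite ger0_norm// exprn_ge0.
      rewrite -seminormZ// -(pdist_eq sp Fa).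
      exact: le_trans (pdist_le0 _ sp _) pa.
    move=> le1; have : t%:R ^+ D.+1 * y <= A * t%:R ^+ D.
      apply: (@le_trans _ _ (t%:R ^+ k * y)).
        by rewrite ler_wpM2r// ler_weXn2l.
      apply: le_trans le1 _; rewrite /A /f -!mulrA ler_wpM2l ?exprn_ge0// ler_wpM2l//.
      rewrite [p2 v * _]mulrC !mulrA ler_wpM2r ?seminorm_ge0// -exprMn.
      rewrite lerXn2r ?nnegrE ?mulr_ge0 ?addr_ge0 ?mulr_ge0//.
      by rewrite mulrDl mul1r -mulrA natrM lerD2r.
    rewrite exprS -mulrA [_ ^+ D * y]mulrC mulrA ler_pM2r ?exprn_gt0 ?ltr0n//.
    by rewrite mulrC.
  apply/eqP; rewrite eq_le y0 andbT leNgt; apply/negP => ylt.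
  (* If y > 0, an integer t above A / y contradicts [bound]; the case t = 1 supplies the sign of
     A. *)
  have := archi_boundP (divr_ge0 (le_trans (mulr_ge0 y0 (ler0n _ 1)) (bound 1%N isT)) y0).
  have := bound (Num.bound (A / y)).+1 isT.
  rewrite ltr_pdivrMr// -natr1 mulrDr mulr1 mulrC => h1 h2; lra.
move=> v e Fv e0.
have H1 : npow rho N V k `<=` [set w | pdist p (Fk k.+1) w = 0].
  have sub : subspace_set [set w : V | pdist p (Fk k.+1) w = 0].
    split=> [|a u u' /= u0 u0']; first exact: seminorm0.
    apply/eqP; rewrite eq_le pdist_ge0// andbT; apply: le_trans (sd.1 _ _) _.
    by rewrite sd.2 u0 u0' mulr0 addr0.
  exact: (@span_set_min _ _ _ (Submod sub)).
have e20 : 0 < e / 2 by rewrite divr_gt0.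
have [u [nu uv]] := Fv _ (continuous_seminorm_nbhs v cp e20).
have [w Fw we] : exists2 w, Fk k.+1 w & p (u + w) < e / 2.
  by apply: pdist_lt => //; rewrite (H1 _ nu).
exists (- w); first exact: (submodN (S := Fk k.+1)).
have -> : v - - w = (u + w) - (u - v) by rewrite opprK opprB [RHS]addrC addrA subrK.
by rewrite [e]splitr; apply: le_lt_trans (seminormB _ _ sp) (ltrD we uv).
Qed.

End Density.
End Words.

(** * Stability of the parabolic subgroup under exponentials *)

Section MatrixSubspaces.
Variables (R : realType) (n : nat).
Implicit Types (S : set 'M[R]_n.+1) (A D : 'M[R]_n.+1).

Definition mxpair A D : R := \sum_i \sum_j A i j * D i j.

Lemma mxpairZD a A A' D : mxpair (a *: A + A') D = a * mxpair A D + mxpair A' D.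
Proof.
rewrite /mxpair mulr_sumr -big_split /=; apply: eq_bigr => i _.
rewrite mulr_sumr -big_split /=; apply: eq_bigr => j _.
by rewrite !mxE mulrDl mulrA.
Qed.

Lemma mxpair0 D : mxpair 0 D = 0.
Proof. by rewrite /mxpair big1// => i _; rewrite big1// => j _; rewrite mxE mul0r. Qed.

Lemma mxpair_sum m (c : 'I_m -> R) (E : 'I_m -> 'M[R]_n.+1) D :
  mxpair (\sum_i c i *: E i) D = \sum_i c i * mxpair (E i) D.
Proof.
apply: (big_ind2 (fun A x => mxpair A D = x)) => [|A x B y <- <-|i _].
- exact: mxpair0.
- by rewrite -[A in LHS]scale1r mxpairZD mul1r.
- by rewrite -[_ *: _]addr0 mxpairZD mxpair0 addr0.
Qed.

Lemma is_derive_mxpair (M : R -> 'M[R]_n.+1) t X D : is_derive t (1 : R) M X ->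
  is_derive t (1 : R) (fun x => mxpair (M x) D) (mxpair X D).
Proof.
move=> /is_derive_mxP dM.
have -> : (fun x => mxpair (M x) D) = \sum_i \sum_j (D i j *: (fun x => M x i j)).
  apply/funext => x; rewrite fct_sumE; apply: eq_bigr => i _.
  by rewrite fct_sumE; apply: eq_bigr => j _; rewrite mulrC.
apply: is_derive_sum => i; apply: is_derive_sum => j.
by rewrite mulrC; exact: is_deriveZ.
Qed.

(** Generators E express brackets through finitely many coefficients, while the equations D turn
    membership into the vanishing of scalar functions. Together they reduce invariance of S under a
    flow to a linear differential system. *)
Lemma subspace_mx_dual S : subspace_set S ->
  exists (m : nat) (E D : 'I_m -> 'M[R]_n.+1),
  [/\ forall i, S (E i),
      forall A, S A -> exists c : 'I_m -> R, A = \sum_i c i *: E i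
    & forall A, S A <-> forall j, mxpair A (D j) = 0].
Proof.
move=> sS; pose S' : submod _ := Submod sS.
have sub : subspace_set [set x : 'rV[R]_(n.+1 * n.+1) | S (vec_mx x)].
  split=> [|a x y Sx Sy] /=; first by rewrite linear0; exact: (submod0 S').
  by rewrite linearP; exact: (submodZD (S := S')).
have [B BP] := subspace_mx sub.
have BP' A : S A <-> (mxvec A <= B)%MS by rewrite -BP /= mxvecK.
exists (n.+1 * n.+1)%N, (fun i => vec_mx (row i B)), (fun j => vec_mx (col j (cokermx B))^T).
split=> [i|A /BP'/submxP[u uB]|A].
- by apply/BP'; rewrite vec_mxK row_sub.
- exists (u 0); rewrite -[LHS]mxvecK uB mulmx_sum_row linear_sum /=.
  by apply: eq_bigr => i _; rewrite linearZ.
- have pairE j : mxpair A (vec_mx (col j (cokermx B))^T) = (mxvec A *m cokermx B) 0 j.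
    rewrite mxE /mxpair pair_bigA /= [RHS](reindex _ (curry_mxvec_bij _ _)) /=.
    apply: eq_bigr => -[i k] _ /=; rewrite mxvecE -[vec_mx _ i k]mxvecE vec_mxK.
    by rewrite !mxE.
  rewrite BP' submxE; split=> [/eqP AB j|AB].
    by rewrite pairE AB mxE.
  by apply/eqP/rowP => j; rewrite -pairE AB mxE.
Qed.

End MatrixSubspaces.

Section Gronwall.
Variable R : realType.

(** Gronwall: phi = sum of the F_i^2 satisfies phi' <= K phi, so phi(t) exp(-K t) is nonincreasing
    and starts at 0. *)
Lemma linear_ode_zero m (F : 'I_m -> R -> R) (c : 'I_m -> 'I_m -> R) :
  (forall i (t : R), is_derive t (1 : R) (F i) (\sum_k c i k * F k t)) ->
  (forall i, F i 0 = 0) -> forall i, F i 1 = 0.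
Proof.
move=> dF F0 i.
pose C := \sum_i \sum_k `|c i k|.
have cC j k : `|c j k| <= C.
  rewrite /C (bigD1 j)//= (bigD1 k)//= -addrA lerDl addr_ge0//.
    exact: sumr_ge0.
  by apply: sumr_ge0 => l _; exact: sumr_ge0.
have C0 : 0 <= C by apply: sumr_ge0 => j _; exact: sumr_ge0.
(* Each product 2 F_j c F_k is at most C (F_j^2 + F_k^2), and the sum over all pairs counts every
   square 2m times. *)
pose K := 2 * m%:R * C.
pose phi := \sum_i (F i ^+ 2).
have phiE t : phi t = \sum_i F i t ^+ 2 by rewrite /phi fct_sumE.
pose dphi t := \sum_i (2 * F i t) * (\sum_k c i k * F k t).
have dphiP (t : R) : is_derive t (1 : R) phi (dphi t).
  have d2 j : is_derive t (1 : R) (F j ^+ 2) (2 * F j t * (\sum_k c j k * F k t)).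
    have := @is_deriveX _ _ (F j) 2 t 1 _ (dF j t).
    by rewrite expr1.
  exact: (is_derive_sum d2).
have dphi_le t : dphi t <= K * phi t.
  apply: (@le_trans _ _ (\sum_j \sum_k C * (F j t ^+ 2 + F k t ^+ 2))).
    apply: ler_sum => j _; rewrite mulr_sumr; apply: ler_sum => k _.
    apply: le_trans (ler_norm _) _.
    have -> : 2 * F j t * (c j k * F k t) = c j k * (2 * F j t * F k t) by ring.
    rewrite normrM ler_pM// ler_norml.
    have := sqr_ge0 (F j t - F k t); have := sqr_ge0 (F j t + F k t).
    by rewrite sqrrB sqrrD => h1 h2; apply/andP; split; lra.
  under eq_bigr do rewrite -mulr_sumr big_split /= sumr_const card_ord -phiE.
  rewrite -mulr_sumr big_split /= sumr_const card_ord sumrMnl -phiE /K.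
  rewrite -mulr_natr le_eqVlt; apply/orP; left; apply/eqP; ring.
pose psi t := phi t * expR (- K * t).
have dexp (t : R) : is_derive t (1 : R) (fun t => expR (- K * t)) (- K * expR (- K * t)).
  have da : is_derive t (1 : R) (fun x => - K * x) (- K).
    by rewrite -[X in is_derive _ _ _ X]mulr1; exact: is_deriveZ.
  have := @is_derive1_comp _ expR _ t _ _ (is_derive_expR _) da.
  by rewrite mulrC.
have dpsi (t : R) : is_derive t (1 : R) psi (expR (- K * t) * (dphi t - K * phi t)).
  have := is_deriveM (dphiP t) (dexp t).
  rewrite /GRing.scale /= => H; apply: is_derive_eq H _.
  by rewrite /GRing.scale /=; ring.
have psi1 : psi 1 <= psi 0.
  have H := @ler0_derive1_le_cc R psi 0 1.
  apply: H; rewrite ?in_itv /= ?lexx ?ler01//.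
  - move=> t _; rewrite derive1E; case: (dpsi t) => _ ->.
    apply: mulr_ge0_le0; [exact: expR_ge0|rewrite subr_le0; exact: dphi_le].
  - apply: continuous_subspaceT => t.
    by apply/differentiable_continuous/derivable1_diffP; case: (dpsi t).
have phi0 : phi 0 = 0 by rewrite phiE big1// => j _; rewrite F0 expr0n.
have : phi 1 <= 0.
  move: psi1; rewrite /psi phi0 mul0r pmulr_lle0//; exact: expR_gt0.
rewrite phiE => le0.
have := le0; rewrite (bigD1 i)//= => le1; apply/eqP; rewrite -sqrf_eq0.
rewrite eq_le sqr_ge0 andbT; apply: le_trans le1.
by rewrite lerDl; apply: sumr_ge0 => j _; exact: sqr_ge0.
Qed.

End Gronwall.

Section ParabolicExp.
Variables (R : realType) (G : topGroupType) (n : nat) (rho : G -> 'M[R]_n.+1).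
Variables (P : set G).
Hypothesis rr : real_reductive rho.
Hypothesis parP : parabolic_subgroup rho P.

Let rho1 : rho 1%g = 1. Proof. by case: rr => _ _ [r1 rM]. Qed.
Let rhoM g h : rho (g * h)%g = rho g * rho h. Proof. by case: rr => _ _ [r1 rM]. Qed.

Lemma parabolic_mul g h : P g -> P h -> P (g * h)%g.
Proof.
have [p _ ->] := parP; rewrite /= => pg ph; rewrite -{2}pg -{2}ph image_comp.
congr image; apply/funext => X /=; rewrite -!(rhoVE rho1 rhoM) invgM !rhoM.
by rewrite !mulrA.
Qed.

(** The pairings of Ad(gamma(t)) E_i with an equation D_j of p vanish at t = 0 and solve the linear
    system whose coefficients express [W, E_i] in the E_k. *)
Lemma one_param_normalizes (p : set 'M[R]_n.+1) W gamma : subspace_set p ->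
  (forall A, p A -> p (W * A - A * W)) -> one_param rho W gamma ->
  forall A, p A -> p (rho (gamma 1) * A * (rho (gamma 1))^-1).
Proof.
move=> sp pW oW A pA; have [m [E [D [pE Espan pD]]]] := subspace_mx_dual sp.
pose Z B t := rho (gamma t) * B * rho (gamma (- t)).
have dZ B (t : R) : is_derive t (1 : R) (Z B) (Z (W * B - B * W) t).
  have := is_derive_mulmx (is_derive_mulmx (one_param_deriv rhoM t oW).2
    (is_derive_cst_mx B t)) (one_param_derivN rhoM t oW).
  by rewrite mulr0 addr0 /Z mulrBr mulrBl mulrN !mulrA.
have E1 : Z A 1 = rho (gamma 1) * A * (rho (gamma 1))^-1.
  by rewrite /Z (one_paramN _ oW) (rhoVE rho1 rhoM).
have /choice[c cP] : forall i, exists c : 'I_m -> R, W * E i - E i * W = \sum_k c k *: E k.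
  by move=> i; apply/Espan/pW/pE.
have ZE B t : Z (\sum_k B k *: E k) t = \sum_k B k *: Z (E k) t.
  by rewrite /Z mulr_sumr mulr_suml; apply: eq_bigr => k _; rewrite -scalerAr -scalerAl.
have [a aE] := Espan _ pA; rewrite -E1 aE ZE; apply/pD => j; rewrite mxpair_sum big1// => k _.
pose F i t := mxpair (Z (E i) t) (D j).
have -> : mxpair (Z (E k) 1) (D j) = 0; last by rewrite mulr0.
apply: (@linear_ode_zero _ _ F c) => [i t|i].
  rewrite /F; have := is_derive_mxpair (D j) (dZ (E i) t).
  by rewrite cP ZE mxpair_sum.
rewrite /F /Z oppr0 (one_param0 oW) rho1 mul1r mulr1.
by apply/(pD (E i)).1; exact: pE.
Qed.

(** Normalizing p is linear at the infinitesimal level: differentiating Ad(g(t)) A in p at t = 0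
    shows that ad X and ad Y preserve p, hence so does ad (X + hY), which is then integrated
    back. *)
Lemma one_param_parabolic X Y (h : R) gamma : LieAlg rho P X -> LieAlg rho P Y ->
  one_param rho (X + h *: Y) gamma -> P (gamma 1).
Proof.
have [p [[sp _] _ _] PE] := parP.
have bracket Z : LieAlg rho P Z -> forall A, p A -> p (Z * A - A * Z).
  move=> [g oZ Pg] A pA; have [m [E [D [_ _ pD]]]] := subspace_mx_dual sp.
  apply/pD => j.
  have d1 := is_derive_mulmx (is_derive_mulmx (one_param_deriv rhoM 0 oZ).1
    (is_derive_cst_mx A 0)) (one_param_derivN rhoM 0 oZ).
  have := is_derive_mxpair (D j) d1.
  have -> : (fun x => mxpair (rho (g x) * A * rho (g (- x))) (D j)) = cst 0.
    apply/funext => x; apply/(pD _).1; move: (Pg x); rewrite PE /= => <-.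
    by exists A => //; rewrite (one_paramN _ oZ) (rhoVE rho1 rhoM).
  rewrite /= oppr0 (one_param0 oZ) rho1 mulr0 addr0 mul1r !mulr1 mulrN => -[_].
  by rewrite derive_cst => <-.
move=> PX PY oW.
pose p' : submod _ := Submod sp.
have pW A : p A -> p ((X + h *: Y) * A - A * (X + h *: Y)).
  move=> pA; rewrite mulrDl mulrDr opprD addrACA addrC -scalerAl -scalerAr -scalerBr.
  by apply: (submodZD (S := p')); exact: bracket.
(* Membership in P asks for an equality of sets; the opposite velocity yields the reverse
   inclusion. *)
have pW' A : p A -> p ((-1 *: (X + h *: Y)) * A - A * (-1 *: (X + h *: Y))).
  move=> pA; rewrite -scalerAl -scalerAr -scalerBr; apply: (submodZ (S := p')).
  exact: pW.
have H1 := one_param_normalizes sp pW oW.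
have H2 := one_param_normalizes sp pW' (one_param_scale (-1) oW).
rewrite mulr1 (one_paramN _ oW) -(rhoVE rho1 rhoM) invgK in H2.
rewrite PE; apply/seteqP; split=> [_ [A pA <-]|A pA]; first exact: H1.
exists (rho (gamma 1%R)^-1%g * A * rho (gamma 1)); first exact: H2.
rewrite -(rhoVE rho1 rhoM) !mulrA -rhoM mulgV rho1 mul1r -mulrA -rhoM mulgV rho1.
by rewrite mulr1.
Qed.

(** If X + hY is the velocity of no one-parameter subgroup, [gexp] returns 1, which is covered by
    [P 1%g]. *)
Lemma gexp_parabolic X Y (h : R) : P 1%g -> LieAlg rho P X -> LieAlg rho P Y ->
  P (gexp rho (X + h *: Y)).
Proof.
move=> P1 PX PY; rewrite /gexp; case: xgetP => [g _ [gamma oW <-]|//].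
exact: one_param_parabolic oW.
Qed.

End ParabolicExp.

(** * The completion *)

Section SmoothTransport.
Variables (R : realType) (V W : topologicalLmodType R[i]) (phi : V -> W).
Hypothesis lphi : linear phi.
Hypothesis cphi : continuous phi.

Lemma within_continuous_comp (T : topologicalType) (A : set T) (f : T -> V)
    (f1 : T -> W) : {within A, continuous f} ->
  (forall x, A x -> f1 x = phi (f x)) -> {within A, continuous f1}.
Proof.
move=> /subspace_continuousP cf f1E; apply/subspace_continuousP => x Ax B nB.
have /cphi/(cf x Ax) nfB : nbhs (phi (f x)) B by rewrite -f1E.
suff : nbhs x [set y | A y -> B (f1 y)] by [].
have : nbhs x [set y | A y -> B (phi (f y))] by exact: nfB.
by apply: filterS => y By Ay; rewrite f1E//; exact: By.
Qed.

(** Agreement of f1 with phi f is asked only at the points X + hY that difference quotients visit,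
    since elsewhere the actions may take junk values. *)
Lemma class_C_comp n k (L U : set 'M[R]_n.+1) (f : 'M[R]_n.+1 -> V)
    (f1 : 'M[R]_n.+1 -> W) : class_C k L U f ->
  (forall X Y (h : R), L X -> L Y -> f1 (X + h *: Y) = phi (f (X + h *: Y))) ->
  class_C k L U f1.
Proof.
elim: k f f1 => [|k IH] f f1 [cf df] f1E.
all: have f1E0 X : L X -> f1 X = phi (f X)
  by move=> LX; have := f1E X X 0 LX LX; rewrite scale0r addr0.
all: split; first by apply: within_continuous_comp cf _ => X [_]; exact: f1E0.
  by [].
move=> Y LY; have [f' df' Cf'] := df Y LY.
exists (phi \o f'); last by apply: IH Cf' _.
move=> X UX; have := deriv0_comp lphi cphi (df' X UX).
by congr Defs.deriv0; apply/funext => h /=; rewrite f1E//; case: UX.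
Qed.

End SmoothTransport.

Section Transport.
Variables (R : realType) (G : topGroupType) (n : nat) (rho : G -> 'M[R]_n.+1).
Variables (s : G -> R) (P : set G) (V W : rep_space R G).
Variables (f : V -> W) (f' : W -> V).
Hypothesis PM : forall g h, P g -> P h -> P (g * h)%g.
Hypothesis Pexp : forall X Y (h : R), LieAlg rho P X -> LieAlg rho P Y ->
  P (gexp rho (X + h *: Y)).
Hypothesis P1 : P 1%g.
Hypothesis mf : rep_morphism P f.
Hypothesis mf' : rep_morphism P f'.
Hypothesis fK : cancel f f'.
Hypothesis f'K : cancel f' f.

Lemma linear_morph (A B : lmodType R[i]) (g : A -> B) : linear g ->
  [/\ g 0 = 0, forall u v, g (u + v) = g u + g v,
      forall u v, g (u - v) = g u - g v & forall a u, g (a *: u) = a *: g u].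
Proof.
move=> lg.
have gB u v : g (u - v) = g u - g v.
  by have := lg (-1) v u; rewrite !scaleN1r [- v + u]addrC [- g v + g u]addrC.
have g0 : g 0 = 0 by rewrite -(subrr 0) gB subrr.
split=> // [u v|a u]; first by have := lg 1 u v; rewrite !scale1r.
by have := lg a u 0; rewrite g0 !addr0.
Qed.

Lemma frechet_transport : frechet V -> frechet W.
Proof.
case: mf mf' => lf cf _ [lf' cf' _] /frechet_graded[[PP gP] cV].
have [f0 fD fB fZ] := linear_morph lf; have [f'0 f'D f'B f'Z] := linear_morph lf'.
have nbhsE (U : set W) : nbhs 0 U <-> nbhs 0 (f @^-1` U).
  split=> [nU|nU]; first by apply: cf; rewrite f0.
  suff -> : U = f' @^-1` (f @^-1` U) by apply: cf'; rewrite f'0.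
  by apply/seteqP; split=> w /=; rewrite f'K.
apply/frechet_graded; split.
  exists (fun m w => PP m (f' w)); case: gP => sP mP zP nP; split.
  - move=> m; split=> [u v|a v]; first by rewrite f'D; exact: (sP m).1.
    by rewrite f'Z; exact: (sP m).2.
  - by move=> j k v; exact: mP.
  - by move=> w w0; rewrite -[w]f'K (zP _ w0).
  - move=> U; split=> [/nbhsE/nP[m [e [e0 eU]]]|[m [e [e0 eU]]]].
      by exists m, e; split=> // w /eU /=; rewrite f'K.
    by apply/nbhsE/nP; exists m, e; split=> // v /= ve; apply: eU; rewrite /= fK.
move=> u cu; have [l ul] : exists l : V, (f' \o u) @ \oo --> l.
  apply: cV => U nU; have : nbhs 0 (f' @^-1` U) by apply: cf'; rewrite f'0.
  by move=> /cu[m mP]; exists m => i j mi mj; rewrite /= -f'B; exact: mP.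
exists (f l); have <- : f \o (f' \o u) = u by apply/funext => i /=; rewrite f'K.
exact: (cvg_comp _ _ ul (cf l)).
Qed.

Lemma in_RepF_transport : in_RepF rho s P V -> in_RepF rho s P W.
Proof.
move=> [fV [[a1 aM] alin acont asm amg]]; split; first exact: frechet_transport.
case: (mf) => lf cf ef; case: (mf') => lf' cf' ef'.
have actE g w : P g -> rep_act g w = f (rep_act g (f' w)).
  by move=> Pg; rewrite -ef'// f'K.
split.
- split=> [w|g h w Pg Ph]; first by rewrite actE// a1 f'K.
  by rewrite !actE//; [rewrite aM// fK|exact: PM].
- by move=> g Pg a u v; rewrite !actE// lf' alin// lf.
- apply/subspace_continuousP => -[g w] [Pg _] /=.
  move/subspace_continuousP: acont => /(_ (g, f' w) (conj Pg I)) /= H B nB.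
  have /cf/H[[A C] /= [nA nC] AC] : nbhs (f (rep_act g (f' w))) B by rewrite -actE.
  exists (A, f' @^-1` C); first by split=> //=; exact: cf'.
  move=> [h x] /= [Ah Cx] [Ph _]; suff : B (rep_act h x) by [].
  rewrite actE//; exact: (AC (h, f' x) (conj Ah Cx) (conj Ph I)).
- move=> w g Pg; have [U oU cU] := asm (f' w) g Pg; exists U => // k.
  apply: (class_C_comp lf cf (cU k)) => X Y h LX LY.
  by rewrite actE//; apply: PM => //; exact: Pexp.
- move=> p1 [[p1D p1Z] cp1].
  have [f0 fD fB fZ] := linear_morph lf; have [f'0 f'D f'B f'Z] := linear_morph lf'.
  have cp : continuous_seminorm (p1 \o f).
    split; first by split=> [u v|a v] /=; rewrite ?fD ?fZ; [exact: p1D|exact: p1Z].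
    by move=> v; apply: (@continuous_comp _ _ _ f p1); [exact: cf|exact: cp1].
  have [r [p2 [r0 [[p2D p2Z] cp2]] H]] := amg _ cp.
  exists r, (p2 \o f'); last by move=> g w Pg; rewrite actE//; exact: H.
  split=> //; split.
    by split=> [u v|a v] /=; rewrite ?f'D ?f'Z; [exact: p2D|exact: p2Z].
  by move=> v; apply: (@continuous_comp _ _ _ f' p2); [exact: cf'|exact: cp2].
Qed.

End Transport.

(** * Quotients by closed invariant subspaces *)

Section QuotientRep.
Variables (R : realType) (G : topGroupType) (n : nat) (rho : G -> 'M[R]_n.+1).
Variables (s : G -> R) (P : set G) (V : rep_space R G) (S : submod V).
Hypothesis RV : in_RepF rho s P V.
Hypothesis cS : closed (S : set V).
Hypothesis SP : forall g v, P g -> S v -> S (rep_act g v).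

Lemma quot_actE g v : P g ->
  rep_act g (qproj S v : quot_rep S) = qproj S (rep_act g v).
Proof.
move=> Pg; apply/qproj_eq; rewrite -(rep_actB RV _ _ Pg); apply: SP => //.
exact: qrepr_proj.
Qed.

Lemma qproj_linear : linear (qproj S).
Proof. by move=> a u v; rewrite qprojD qprojZ. Qed.

Lemma quot_in_RepF : in_RepF rho s P (quot_rep S).
Proof.
case: (RV) => fV [[a1 aM] alin acont asm amg]; split; first exact: quot_frechet.
split.
- split=> [x|g h x Pg Ph]; first by rewrite -[x]qreprK /= a1 qreprK.
  by rewrite -[x in RHS]qreprK !quot_actE// -aM.
- move=> g Pg a x y; rewrite -[x]qreprK -[y]qreprK -qproj_linear !quot_actE//.
  by rewrite alin// qproj_linear.
- apply/subspace_continuousP => -[g x] [Pg _] /= B nB.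
  move/subspace_continuousP: acont => /(_ (g, qrepr x) (conj Pg I)) /=.
  move=> /(_ _ (@qproj_continuous _ _ S _ _ nB)) [[A C] /= [nA nC] AC].
  exists (A, qproj S @` C).
    by split=> //=; rewrite -[x]qreprK; exact: nbhs_qproj.
  move=> [h _] /= [Ah [c Cc <-]] [Ph _] /=.
  have := AC (h, c) (conj Ah Cc) (conj Ph I); rewrite /=.
  by have /= <- := quot_actE c Ph.
- move=> x g Pg; have [U oU cU] := asm (qrepr x) g Pg; exists U => // k.
  apply: (class_C_comp qproj_linear (@qproj_continuous _ _ S) (cU k)) => X Y h LX LY.
  by [].
- move=> p1 [[p1D p1Z] cp1].
  have cp : continuous_seminorm (p1 \o qproj S).
    split; first by split=> [u v|a v] /=; rewrite ?qprojD ?qprojZ; [exact: p1D|exact: p1Z].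
    move=> v; apply: (@continuous_comp _ _ _ (qproj S) p1); last exact: cp1.
    exact: qproj_continuous.
  have [r [p2 [r0 cp2] H]] := amg _ cp.
  exists r, (fun x : qspace S => pdist p2 S (qrepr x)).
    by split=> //; exact: quot_continuous_seminorm.
  (* The estimate holds for every representative of x; to take the infimum one divides by the scale
     factor, whose vanishing is treated apart. *)
  move=> g x Pg; have [s0|s0] := eqVneq (s g `^ r) 0.
    rewrite s0 mul0r; have := H g (qrepr x) Pg.
    by rewrite s0 mul0r.
  have sg : 0 < s g `^ r by rewrite lt_neqAle eq_sym s0 powR_ge0.
  case: cp2 => sp2 _; rewrite -ler_pdivrMl//; apply: le_pdist => // w Sw.
  rewrite ler_pdivrMl//; have := H g (qrepr x + w) Pg; rewrite /= -quot_actE//.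
  suff -> : qproj S (qrepr x + w) = x by [].
  by rewrite -[RHS]qreprK; apply/qproj_eq; rewrite addrAC subrr add0r.
Qed.

End QuotientRep.

(** * The completion as a quotient, and its functoriality *)

Section CompletionLimit.
Variables (R : realType) (G : topGroupType) (n : nat) (rho : G -> 'M[R]_n.+1).
Variables (s : G -> R) (P N : set G).
Hypothesis rr : real_reductive rho.
Hypothesis scale_s : algebraic_scale rho s.
Hypothesis parP : parabolic_subgroup rho P.
Hypothesis uN : unipotent_normal rho P N.

Let P1 : P 1%g. Proof. by case: uN => -[N1 _ _] NP _ _ _; exact: NP. Qed.

Section One.
Variable V : rep_space R G.
Hypothesis RV : in_RepF rho s P V.
Local Notation F := (npow_filtration rho N V).

Let Finv k g v : P g -> F k v -> F k (rep_act g v).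
Proof. exact: (npow_inv rr uN RV). Qed.

Lemma lim_act_proj g (x : CJ rho N V) k v : P g ->
  (x : invlim F) k = qproj (F k) v ->
  (rep_act g x : invlim F) k = qproj (F k) (rep_act g v).
Proof.
move=> Pg xk.
(* Coherence of the translated family excludes the junk branch of [lim_act]. *)
have co : coherent (fun k => @rep_act _ _ (quot_rep (F k)) g ((x : invlim F) k)).
  move=> j l jl; set u := qrepr ((x : invlim F) l).
  have xl : (x : invlim F) l = qproj (F l) u by rewrite qreprK.
  rewrite xl (coherent_lift jl xl) !(quot_actE RV (@Finv _))//.
  by apply/qproj_eq/(filtrP jl)/qrepr_proj.
rewrite /= /lim_act; case: pselect => [gx|/(_ co)//] /=.
by rewrite xk; apply: (quot_actE RV (@Finv _)).
Qed.

Lemma lim_act_nat g (v : V) : P g ->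
  rep_act g (CJ_nat rho N v) = CJ_nat rho N (rep_act g v).
Proof. by move=> Pg; apply: invlim_ext => k; exact: lim_act_proj. Qed.

Lemma CJ_nat_linear : linear (@CJ_nat R G n rho N V).
Proof. by move=> a u v; apply: invlim_ext => k /=; rewrite qprojD qprojZ. Qed.

Lemma CJ_nat_continuous : continuous (@CJ_nat R G n rho N V).
Proof. by apply: continuous_to_lim => k; exact: qproj_continuous. Qed.

Lemma CJ_nat_eq (u v : V) : CJ_nat rho N u = CJ_nat rho N v <-> CJs rho N V (u - v).
Proof.
split=> [uv k _|uv].
  by apply/qproj_eq; have /(congr1 (fun x : invlim F => x k)) := uv.
by apply: invlim_ext => k; apply/qproj_eq; exact: uv.
Qed.

Lemma CJs_closed : closed (CJs rho N V : set V).
Proof. by apply: closed_bigI => k _; exact: closed_closure. Qed.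

Lemma CJs_inv g v : P g -> CJs rho N V v -> CJs rho N V (rep_act g v).
Proof. by move=> Pg Sv k _; apply: Finv => //; exact: Sv. Qed.

Lemma CJ_mittag_leffler (PP : nat -> V -> R) : graded PP -> exists K : nat -> nat,
  forall (x : CJ rho N V) m u (e : R), 0 < e -> (x : invlim F) (K m) = qproj _ u ->
    exists2 v : V, CJ_nat rho N v = x & PP m (v - u) <= e.
Proof.
move=> gP; case: (RV) => /frechet_graded[_ cV] _.
apply: mittag_leffler => // [k|m]; first exact: closed_closure.
exact: (npow_dense rr uN scale_s RV (graded_continuous m gP)).
Qed.

Lemma CJ_nat_surjective (x : CJ rho N V) : exists v : V, CJ_nat rho N v = x.
Proof.
case: (RV) => /frechet_graded[[PP gP] _] _.
have [K KP] := CJ_mittag_leffler gP.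
have [v vx _] := KP x 0%N (qrepr ((x : invlim F) (K 0%N))) 1 ltr01 (esym (qreprK _)).
by exists v.
Qed.

Lemma CJ_iso : exists (f : quot_rep (CJs rho N V) -> CJ rho N V)
    (f' : CJ rho N V -> quot_rep (CJs rho N V)),
  [/\ rep_morphism P f, rep_morphism P f', cancel f f' & cancel f' f].
Proof.
(* The chosen lift need not be linear; its ambiguity lies in [CJs], so its class in the quotient
   is. *)
have /choice[lift liftP] := CJ_nat_surjective.
pose S := CJs rho N V.
pose f (x : quot_rep S) : CJ rho N V := CJ_nat rho N (qrepr (x : qspace S)).
pose f' (y : CJ rho N V) : quot_rep S := qproj S (lift y).
have fE (v : V) : f (qproj S v) = CJ_nat rho N v by apply/CJ_nat_eq; exact: qrepr_proj.
have f'E (v : V) : f' (CJ_nat rho N v) = qproj S v by apply/qproj_eq/CJ_nat_eq.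
have fK : cancel f f' by move=> x; rewrite -[x]qreprK fE f'E.
have f'K : cancel f' f by move=> y; rewrite fE.
have aE g v := @quot_actE _ _ _ _ _ _ _ S RV CJs_inv g v.
have lf : linear f.
  move=> a x y; rewrite -[x]qreprK -[y]qreprK -(qproj_linear S) !fE.
  exact: CJ_nat_linear.
have lf' : linear f'.
  move=> a x y; rewrite -(liftP x) -(liftP y) -CJ_nat_linear !f'E.
  exact: (qproj_linear S).
exists f, f'; split=> //; split=> //.
- move=> x B; rewrite -[x]qreprK fE => /CJ_nat_continuous nB.
  have := @nbhs_qproj _ _ S _ _ nB; apply: filterS => _ [v /= Bv <-].
  by rewrite /= fE.
- by move=> g x Pg; rewrite -[x]qreprK aE// !fE lim_act_nat.
- case: (RV) => /frechet_graded[[PP gP] _] _; have [K KP] := CJ_mittag_leffler gP.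
  have sP m : seminorm (PP m) by case: gP.
  have [f'0 _ f'B _] := linear_morph lf'.
  (* A neighbourhood in the limit is cut out by the coordinate K m alone: if it has a representative
     u with P m u < e/2, the uniform lifting gives a lift with P m below e. *)
  have c0 (B : set (qspace S)) : nbhs 0 B -> nbhs (0 : CJ rho N V) (f' @^-1` B).
    case: (gP) => _ _ _ nP; move=> /nbhs0_qproj/nP[m [e [e0 eB]]].
    have e20 : 0 < e / 2 by rewrite divr_gt0.
    have n2 := continuous_seminorm_nbhs 0 (graded_continuous m gP) e20.
    have := @lim_proj_continuous _ _ F (K m) (0 : invlim F).
    move=> /(_ (qproj (F (K m)) @` [set u | PP m (u - 0) < e / 2])).
    have -> : (0 : invlim F) (K m) = qproj (F (K m)) 0.
      by have [/(congr1 (fun x : invlim F => x (K m))) <-] := linear_morph CJ_nat_linear.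
    move=> /(_ (@nbhs_qproj _ _ (F (K m)) _ _ n2)) H.
    apply: (@filterS _ (nbhs (0 : invlim F)) _ _ _ _ H) => y [u /= ue /esym yu].
    have [v <- ve] := KP y m u _ e20 yu.
    rewrite /= f'E; apply: eB => /=.
    have -> : v = (v - u) + u by rewrite subrK.
    rewrite [e]splitr; apply: le_lt_trans ((sP m).1 _ _) _.
    by apply: ler_ltD => //; rewrite subr0 in ue.
  move=> y B /nbhs_addr/c0 nB; apply/nbhs_addr.
  apply: filterS nB => z /=; have [_ f'D _ _] := linear_morph lf'.
  by rewrite f'D.
- move=> g y Pg; rewrite -(liftP y) lim_act_nat// !f'E.
  by rewrite aE.
Qed.

Lemma CJs_quot_in_RepF : in_RepF rho s P (quot_rep (CJs rho N V)).
Proof. by apply: (quot_in_RepF RV CJs_closed) => g v; exact: CJs_inv. Qed.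

Lemma CJ_in_RepF : in_RepF rho s P (CJ rho N V).
Proof.
have [f [f' [mf mf' fK f'K]]] := CJ_iso.
apply: (in_RepF_transport _ _ P1 mf mf' fK f'K CJs_quot_in_RepF).
  exact: (parabolic_mul rr parP).
by move=> X Y h; apply: (gexp_parabolic rr parP).
Qed.

End One.

Lemma lie_monomials_morph (V W : rep_space R G) (f : V -> W) k v :
  rep_morphism P f -> in_RepF rho s P V ->
  @lie_monomials _ _ _ rho N V k v -> @lie_monomials _ _ _ rho N W k (f v).
Proof.
move=> [lf cf ef] RV; elim: k v => //= k IH w [X NX [v mv vw]].
exists X => //; exists (f v); first exact: IH.
have := deriv0_comp lf cf vw; congr Defs.deriv0; apply/funext => t /=.
case: NX => gamma oX gN; rewrite ef//.
case: (rr) => hG _ [r1 rM] kf _; rewrite (gexp_scale hG r1 rM kf t oX).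
exact: (unipotent_normal_sub uN (gN t)).
Qed.

Lemma npow_morph (V W : rep_space R G) (f : V -> W) k v :
  rep_morphism P f -> in_RepF rho s P V ->
  npow_filtration rho N V k v -> npow_filtration rho N W k (f v).
Proof.
move=> mf RV; case: (mf) => lf cf _.
have H : npow rho N V k `<=` [set v | npow rho N W k (f v)].
  have sub : subspace_set [set v | npow rho N W k (f v)].
    have [f0 _ _ _] := linear_morph lf.
    split=> [|a u u' nu nu'] /=; first by rewrite f0; exact: (submod0 (npow rho N W k)).
    by rewrite lf; exact: (submodZD (S := npow rho N W k)).
  apply: (@span_set_min _ _ _ (Submod sub)) => u mu /=.
  by apply: sub_span_set; exact: lie_monomials_morph.
move=> cv B /cf/cv[u [nu Bu]].
by exists (f u); split=> //; exact: H.
Qed.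

(** The action of the functor on arrows: a continuous equivariant map sends monomials to monomials,
    hence F_k to F_k, and the induced maps on the quotients are continuous because the projections
    are open. *)
Lemma CJ_functorial (V W : rep_space R G) (f : V -> W) :
  in_RepF rho s P V -> in_RepF rho s P W -> rep_morphism P f ->
  exists2 F, CJ_map f F & rep_morphism P (F : CJ rho N V -> CJ rho N W).
Proof.
move=> RV RW mf; case: (mf) => lf cf ef.
have [f0 fD fB fZ] := linear_morph lf.
have fE k (x : qspace (npow_filtration rho N V k)) v : x = qproj _ v ->
    qproj (npow_filtration rho N W k) (f (qrepr x)) = qproj _ (f v).
  move=> ->; apply/qproj_eq; rewrite -fB; apply: npow_morph mf RV _.
  exact: qrepr_proj.
have co (x : invlim (npow_filtration rho N V)) :
    coherent (fun k => qproj (npow_filtration rho N W k) (f (qrepr (x k)))).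
  move=> j k jk; rewrite [RHS](fE _ _ (qrepr (x k))); last first.
    by apply: (coherent_lift jk); rewrite qreprK.
  by apply/qproj_eq/(filtrP jk)/qrepr_proj.
pose F (x : CJ rho N V) : CJ rho N W := Invlim (co x).
have FE (x : CJ rho N V) k v : (x : invlim (npow_filtration rho N V)) k = qproj _ v ->
    (F x : invlim (npow_filtration rho N W)) k = qproj _ (f v).
  exact: fE.
exists F => //; split.
- move=> a x y; apply: invlim_ext => k.
  set u := qrepr ((x : invlim _) k); set v := qrepr ((y : invlim _) k).
  have xk : (x : invlim _) k = qproj _ u by rewrite qreprK.
  have yk : (y : invlim _) k = qproj _ v by rewrite qreprK.
  rewrite (FE _ k (a *: u + v)); last by rewrite /= xk yk qprojD qprojZ.
  by rewrite lf qprojD qprojZ -(FE _ _ _ xk) -(FE _ _ _ yk).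
- apply: continuous_to_lim => k x B /=.
  set u := qrepr ((x : invlim _) k) => /(@qproj_continuous _ _ _ _ _)/cf nB.
  have := @nbhs_qproj _ _ (npow_filtration rho N V k) _ _ nB.
  rewrite qreprK => /(@lim_proj_continuous _ _ _ k x) H.
  apply: (@filterS _ (nbhs (x : invlim _)) _ _ _ _ H) => y [v /= Bv /esym yv].
  by rewrite /= (fE _ _ v).
- move=> g x Pg; apply: invlim_ext => k.
  set u := qrepr ((x : invlim _) k).
  have xk : (x : invlim _) k = qproj _ u by rewrite qreprK.
  rewrite (FE _ _ _ (lim_act_proj RV Pg xk)) ef//.
  by rewrite (lim_act_proj RW Pg (FE _ _ _ xk)).
Qed.

End CompletionLimit.

Theorem proposition6p1 (R : realType) (G : topGroupType) (n : nat)
    (rho : G -> 'M[R]_n.+1) (s : G -> R) (P N : set G)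
    (pi : rep_space R G) :
  real_reductive rho -> algebraic_scale rho s ->
  parabolic_subgroup rho P -> unipotent_radical rho P N ->
  in_RepF rho s P pi ->
  [/\ in_RepF rho s P (CJ rho N pi) /\
      (forall (sigma : rep_space R G) (f : pi -> sigma),
         in_RepF rho s P sigma -> rep_morphism P f ->
         exists2 F, CJ_map f F &
           rep_morphism P (F : CJ rho N pi -> CJ rho N sigma)),
      (forall x : CJ rho N pi, exists v : pi, CJ_nat rho N v = x)
    & in_RepF rho s P (quot_rep (CJs rho N pi)) /\
      rep_iso P (quot_rep (CJs rho N pi)) (CJ rho N pi)].
Proof.
move=> rr scale_s parP [uN _] RV; split.
- split; first exact: (CJ_in_RepF rr scale_s parP uN RV).
  by move=> sigma f Rs mf; exact: (CJ_functorial rr uN RV Rs mf).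
- exact: (CJ_nat_surjective rr scale_s uN RV).
- by split; [exact: (CJs_quot_in_RepF rr uN RV)|exact: (CJ_iso rr scale_s uN RV)].
Qed.
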